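(* Let $f\in C^1(\mathbf R)$ and let $u$ be a stable classical solution of $$-\operatorname{div}(\gamma(\mathbf x')\nabla u(\mathbf x))=\lambda(\mathbf x')f(u(\mathbf x)),\qquad \mathbf x=(\mathbf x',\mathbf x'')\in\mathbf{R}^d\times\mathbf{R}^s=\mathbf{R}^n.$$ Then for every $\phi\in C_c^1(\mathbf R^n)$, $$\int_{\mathbf x'\in\mathbf R^d}\gamma(\mathbf x')\int_{\mathbf x''\in\mathbf R^s\cap\{\nabla_{\mathbf x''}u\ne0\}}\phi^2\left(|\nabla_{\mathbf x''}u|^2\mathcal K^2+\big|\nabla_T|\nabla_{\mathbf x''}u|\big|^2\right)d\mathbf x''\,d\mathbf x'+\int_{\mathbf R^n}\gamma(\mathbf x')\,\phi^2\,\mathcal S\,d\mathbf x\le\int_{\mathbf R^n}\gamma(\mathbf x')\,|\nabla_{\mathbf x''}u|^2|\nabla\phi|^2\,d\mathbf x,$$ where $$\mathcal S:=\sum_{j=d+1}^{n}\sum_{i=1}^{d}|\partial_i\partial_ju|^2-\big|\nabla_{\mathbf x'}|\nabla_{\mathbf x''}u|\big|^2 .$$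
   Context: Here $d,s\ge 1$ are integers and $n=d+s$. The weights $\gamma,\lambda$ are smooth functions on $\mathbf R^d$ with $\gamma>0$ and $\lambda>0$ (except that $\lambda$ is allowed to vanish, say, at a point). $\nabla_{\mathbf x'}$ and $\nabla_{\mathbf x''}$ denote the gradients with respect to the first $d$ and the last $s$ variables. A classical solution $u$ is stable if for all $\psi\in C_c^1(\mathbf R^n)$, $$\int_{\mathbf R^n}\lambda(\mathbf x')f'(u)\psi^2\,d\mathbf x\le\int_{\mathbf R^n}\gamma(\mathbf x')|\nabla\psi|^2\,d\mathbf x.$$ At a point $\mathbf x=(\mathbf x',\mathbf x'')$ with $\nabla_{\mathbf x''}u(\mathbf x)\neq0$, consider the level set through $\mathbf x''$ of the function $u(\mathbf x',\cdot)$ on $\mathbf R^s$ (with $\mathbf x'$ fixed), which is locally a hypersurface in $\mathbf R^s$. Let $\kappa_1(\mathbf x),\dots,\kappa_{s-1}(\mathbf x)$ be its principal curvatures at that point; the full curvature is $\mathcal K(\mathbf x)=\sqrt{\sum_{j=1}^{s-1}\kappa_j(\mathbf x)^2}$. $\nabla_T$ denotes the orthogonal projection of the gradient (in $\mathbf x''$) onto the tangent space of this level set. The function $|\nabla_{\mathbf x''}u|$ is locally Lipschitz, so its gradient in $\mathcal S$ is defined almost everywhere. *)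

(* Defs.v *)
From HB Require Import structures.
From mathcomp Require Import all_boot all_order all_algebra.
From mathcomp Require Import all_classical all_reals all_analysis.
From mathcomp Require Import measurable_realfun.

Set Implicit Arguments.
Unset Strict Implicit.
Unset Printing Implicit Defensive.

Import Order.TTheory GRing.Theory Num.Theory.
Import numFieldNormedType.Exports.

Local Open Scope classical_set_scope.
Local Open Scope ring_scope.

(** Lebesgue measure on R^n, with its Borel sigma-algebra *)

Definition borel_rV (R : realType) (n : nat) : measurableType _ :=
  g_sigma_algebraType (@open 'rV[R]_n).

Section lebesgue_rV_construction.
Variable R : realType.

Let coord_ball_open n (q : 'rV[R]_n) (e : R) : 0 < e ->
  [set y : 'rV[R]_n | forall i, `|q 0 i - y 0 i| < e] = ball q e.
Proof.
move=> e0; apply/seteqP; split => y /=.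
  by move=> qy; split=> // i j; rewrite ord1; exact: qy.
by case=> _ qy i; exact: qy.
Qed.

Let open_rational_boxes n (O : set 'rV[R]_n) : open O ->
  O = \bigcup_(p in [set p : 'rV[rat]_n * nat |
        ball (map_mx ratr p.1 : 'rV[R]_n) p.2.+1%:R^-1 `<=` O])
      ball (map_mx ratr p.1 : 'rV[R]_n) p.2.+1%:R^-1.
Proof.
move=> oO; apply/seteqP; split=> [x Ox|x [p /= pO px]]; last exact: pO.
have /nbhs_ballP[e /= e0 eO] : nbhs x O by exact: open_nbhs_nbhs.
have [k ke] : exists k : nat, (k.+1%:R : R)^-1 < e / 2.
  have [k _ ke] := near_infty_natSinv_lt (PosNum (divr_gt0 e0 (ltr0n R 2))).
  by exists k; exact: ke k (leqnn k).
have k0 : (0 : R) < k.+1%:R^-1 by rewrite invr_gt0 ltr0n.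
have qP i : exists q : rat, `|ratr q - x 0 i| < (k.+1%:R : R)^-1.
  have : x 0 i < x 0 i + k.+1%:R^-1 by rewrite ltrDl.
  move=> /rat_in_itvoo[q]; rewrite in_itv/= => /andP[q1 q2]; exists q.
  by rewrite ger0_norm ?subr_ge0 ?(ltW q1)// ltrBlDl.
have [q qx] := choice qP.
exists (\row_i q i, k) => /=; last first.
  by rewrite -coord_ball_open// => i; rewrite !mxE.
apply: subset_trans eO => y; rewrite -coord_ball_open//= => qy.
rewrite -coord_ball_open// => i; rewrite [ltRHS]splitr.
have := qy i; rewrite !mxE => qyi.
rewrite (le_lt_trans (ler_distD (ratr (q i)) _ _))// ltrD//.
  by rewrite distrC (lt_trans (qx i)).
exact: lt_trans qyi ke.
Qed.

Lemma measurable_fun_borel_rV d (T : measurableType d) n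
    (f : T -> borel_rV R n) :
  (forall i, measurable_fun [set: T] (fun t => f t 0 i : measurableTypeR R)) ->
  measurable_fun [set: T] f.
Proof.
move=> mf.
apply: (@measurability _ _ T (borel_rV R n) setT f (@open 'rV[R]_n) erefl).
move=> _ [U oU <-]; rewrite setTI (open_rational_boxes oU).
rewrite preimage_bigcup bigcup_mkcond.
apply: countable_bigcupT_measurable => [|[q k]]; first exact: countableP.
case: ifPn => // _.
have k0 : (0 : R) < k.+1%:R^-1 by rewrite invr_gt0 ltr0n.
rewrite /= -coord_ball_open// (_ : _ @^-1` _ = \big[setI/setT]_(i < n)
  ((fun t => f t 0 i) @^-1` ball (ratr (q 0 i) : R) k.+1%:R^-1)); last first.
  apply/seteqP; split => t /=.
    by move=> H; rewrite -bigcap_seq => i _ /=; have := H i; rewrite !mxE.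
  by rewrite -bigcap_seq => H i; rewrite mxE; apply: H; rewrite /= mem_index_enum.
elim/big_ind : _ => //; first by move=> *; exact: measurableI.
move=> i _; rewrite -[X in measurable X]setTI; apply: mf => //.
exact: (open_measurable (ball_open (ratr (q 0 i) : R) _)).
Qed.

Lemma continuous_measurable_borel_rV n (g : 'rV[R]_n -> R) : continuous g ->
  measurable_fun [set: borel_rV R n] (g : borel_rV R n -> measurableTypeR R).
Proof.
move=> cg; apply: (measurability _ (RGenOpens.measurableE R)).
move=> _ [_ [a [b ->] <-]]; rewrite setTI; apply: sub_sigma_algebra.
by move/continuousP : cg; apply; exact: interval_open.
Qed.

Definition cons_rV n (p : measurableTypeR R * borel_rV R n) : borel_rV R n.+1 :=
  row_mx (const_mx p.1 : 'rV_1) p.2.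

Lemma measurable_cons_rV n : measurable_fun [set: _] (@cons_rV n).
Proof.
apply: measurable_fun_borel_rV => i; case: (@split_ordP 1 n i) => j ->.
  rewrite (_ : (fun _ => _) = fst)//.
  by apply/funext => p; rewrite [LHS](@row_mxEl R 1 1 n) mxE.
rewrite (_ : (fun _ => _) =
  (fun x : borel_rV R n => x 0 j : measurableTypeR R) \o snd); last first.
  by apply/funext => p; rewrite [LHS](@row_mxEr R 1 1 n).
apply: measurableT_comp => //.
exact: (continuous_measurable_borel_rV (@coord_continuous R 1 n 0 j)).
Qed.

Lemma measurable_cons_rV_inv n : measurable_fun [set: borel_rV R n.+1]
  (fun x : borel_rV R n.+1 => (x 0 ord0 : measurableTypeR R,
     \row_(j < n) x 0 (lift ord0 j) : borel_rV R n)).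
Proof.
apply/measurable_fun_pairP; split => /=.
  exact: (continuous_measurable_borel_rV (@coord_continuous R 1 n.+1 0 ord0)).
apply: measurable_fun_borel_rV => j.
rewrite (_ : (fun _ => _) =
  (fun x : borel_rV R n.+1 => x 0 (lift ord0 j) : measurableTypeR R)).
  exact: (continuous_measurable_borel_rV
            (@coord_continuous R 1 n.+1 0 (lift ord0 j))).
by apply/funext => x /=; rewrite mxE.
Qed.

Lemma cons_rVK n : cancel (fun x : borel_rV R n.+1 =>
  (x 0 ord0 : measurableTypeR R, \row_(j < n) x 0 (lift ord0 j) : borel_rV R n))
  (@cons_rV n).
Proof.
move=> x; apply/rowP => i; rewrite /cons_rV/=.
case: (@split_ordP 1 n i) => j ->.
  rewrite (@row_mxEl R 1 1 n) mxE (ord1 j); congr (x 0 _); exact/val_inj.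
rewrite (@row_mxEr R 1 1 n) mxE; congr (x 0 _); exact/val_inj.
Qed.

Lemma cons_rV_inj n : injective (@cons_rV n).
Proof.
move=> [a x] [b y]; rewrite /cons_rV/= => /(@eq_row_mx R 1 1 n)[ab ->].
by move/matrixP : ab => /(_ 0 0); rewrite !mxE => ->.
Qed.

Let product_sigma_finite d1 d2 (T1 : measurableType d1) (T2 : measurableType d2)
    (m1 : {sigma_finite_measure set T1 -> \bar R})
    (m2 : {sigma_finite_measure set T2 -> \bar R}) :
  sigma_finite setT (m1 \x m2)%E.
Proof.
have /sigma_finiteP[F [TF ndF Foo]] := sigma_finiteT m1.
have /sigma_finiteP[G [TG ndG Goo]] := sigma_finiteT m2.
exists (fun n => F n `*` G n).
  rewrite -setXTT TF TG predeqE => -[x y]; split.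
    move=> [/= [n _ Fnx] [k _ Gky]]; exists (maxn n k) => //; split.
    - by move: x Fnx; exact/subsetPset/ndF/leq_maxl.
    - by move: y Gky; exact/subsetPset/ndG/leq_maxr.
  by move=> [n _ []/= ? ?]; split; exists n.
move=> k; have [? ?] := Foo k; have [? ?] := Goo k.
split; first exact: measurableX.
by rewrite product_measure1E// lte_mul_pinfty// ge0_fin_numE.
Qed.

Section step.
Variables (n : nat) (m : {sigma_finite_measure set (borel_rV R n) -> \bar R}).

Definition lebesgue_rV_step : set (borel_rV R n.+1) -> \bar R :=
  pushforward (lebesgue_measure \x m)%E (@cons_rV n).

Let step0 : lebesgue_rV_step set0 = 0%E.
Proof. by rewrite /lebesgue_rV_step /pushforward preimage_set0 measure0. Qed.

Let step_ge0 A : (0 <= lebesgue_rV_step A)%E.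
Proof. by rewrite /lebesgue_rV_step /pushforward; exact: measure_ge0. Qed.

Let step_sigma_additive : semi_sigma_additive lebesgue_rV_step.
Proof.
have mc (A : set (borel_rV R n.+1)) :
    measurable A -> measurable (@cons_rV n @^-1` A).
  by move=> mA; rewrite -[X in measurable X]setTI; exact: measurable_cons_rV.
move=> F mF tF mUF; rewrite /lebesgue_rV_step /pushforward preimage_bigcup.
apply: measure_semi_sigma_additive.
- by move=> k; exact: mc.
- apply/trivIsetP => /= i j _ _ ij; rewrite -preimage_setI.
  by move/trivIsetP : tF => /(_ _ _ _ _ ij) ->//; rewrite preimage_set0.
- by rewrite -preimage_bigcup; exact: mc.
Qed.

HB.instance Definition _ := isMeasure.Build _ _ _ lebesgue_rV_step
  step0 step_ge0 step_sigma_additive.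

Let step_sigma_finite : sigma_finite setT lebesgue_rV_step.
Proof.
have [F TF mF] := product_sigma_finite lebesgue_measure m.
pose g (x : borel_rV R n.+1) := (x 0 ord0 : measurableTypeR R,
  \row_(j < n) x 0 (lift ord0 j) : borel_rV R n).
exists (fun k => g @^-1` F k).
  by rewrite -preimage_bigcup -TF preimage_setT.
move=> k; have [mFk Fkoo] := mF k; split.
  rewrite -[X in measurable X]setTI.
  exact: measurable_cons_rV_inv.
rewrite /lebesgue_rV_step /pushforward -comp_preimage (_ : g \o _ = id)//.
by apply/funext => p /=; apply: cons_rV_inj; rewrite cons_rVK.
Qed.

HB.instance Definition _ := Measure_isSigmaFinite.Build _ _ _ lebesgue_rV_step
  step_sigma_finite.

End step.

(* Unit mass on R^0, and the product measure along R * R^n ~ R^(n+1). *)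
Fixpoint lebesgue_rV n : {sigma_finite_measure set (borel_rV R n) -> \bar R} :=
  if n is k.+1 then lebesgue_rV_step (lebesgue_rV k)
  else \d_(0 : borel_rV R 0).

End lebesgue_rV_construction.

Section euclidean_calculus.
Variable R : realType.

(* The library norm on 'rV[R]_n is the sup norm, hence the following. *)
Definition dot n (v w : 'rV[R]_n) : R := \sum_(i < n) v 0 i * w 0 i.
Definition enorm n (v : 'rV[R]_n) : R := Num.sqrt (dot v v).

Definition partial n (i : 'I_n) (f : 'rV[R]_n -> R) : 'rV[R]_n -> R :=
  'D_(delta_mx 0 i) f.

Definition grad n (f : 'rV[R]_n -> R) (x : 'rV[R]_n) : 'rV[R]_n :=
  \row_i partial i f x.

Fixpoint Ck (k : nat) n (f : 'rV[R]_n -> R) : Prop :=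
  if k is k'.+1 then
    (forall x, differentiable f x) /\ (forall i, Ck k' (partial i f))
  else continuous f.

Definition smooth n (f : 'rV[R]_n -> R) : Prop := forall k, Ck k f.

Definition C1c n (f : 'rV[R]_n -> R) : Prop :=
  Ck 1 f /\ compact (closure [set x | f x != 0]).

Definition C1_real (f : R -> R) : Prop :=
  (forall t, derivable f t 1) /\ continuous (derive1 f).

End euclidean_calculus.

(** Geometry of the level set [{z | g z = g y}] at a point [y] where
    [grad g y != 0]. *)

Section level_sets.
Variables (R : realType) (s : nat).
Implicit Types (g : 'rV[R]_s -> R) (y v : 'rV[R]_s).

Definition unit_normal g y : 'rV[R]_s := (enorm (grad g y))^-1 *: grad g y.

Definition tangent_space g y : set 'rV[R]_s :=
  [set v | dot v (unit_normal g y) = 0].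

Definition tangent_proj g y v : 'rV[R]_s :=
  v - dot v (unit_normal g y) *: unit_normal g y.

(* On tangent vectors the derivative of [unit_normal g] only depends on its
   restriction to the level set, i.e. on the Gauss map. *)
Definition shape_operator g y v : 'rV[R]_s := - 'D_v (unit_normal g) y.

(* [kappa] lists the eigenvalues of the shape operator on the
   (s-1)-dimensional tangent space, with multiplicity: [e] is an orthonormal
   basis of principal directions. *)
Definition is_principal_curvatures g y (kappa : 'rV[R]_s.-1) : Prop :=
  exists e : 'I_s.-1 -> 'rV[R]_s,
    [/\ forall i, tangent_space g y (e i),
        forall i j, dot (e i) (e j) = (i == j)%:R &
        forall i, shape_operator g y (e i) = kappa 0 i *: e i].

(* For [g] of class C^2 and [grad g y != 0] the shape operator is self-adjoint
   on the tangent space, so that such a [kappa] exists; it is unique up to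
   order. *)
Definition principal_curvatures g y : 'rV[R]_s.-1 :=
  get (is_principal_curvatures g y).

Definition full_curvature g y : R :=
  Num.sqrt (\sum_(j < s.-1) (principal_curvatures g y 0 j) ^+ 2).

End level_sets.

(** The weighted equation on R^(d+s); a point [x] has components
    [x' = lsubmx x] in R^d and [x'' = rsubmx x] in R^s. *)

Section weighted_equation.
Variables (R : realType) (d s : nat).
Implicit Types (gamma lambda : 'rV[R]_d -> R) (f : R -> R).
Implicit Types (u h : 'rV[R]_(d + s) -> R).

Definition grad_l h (x : 'rV[R]_(d + s)) : 'rV[R]_d :=
  \row_i partial (lshift s i) h x.
Definition grad_r h (x : 'rV[R]_(d + s)) : 'rV[R]_s :=
  \row_j partial (rshift d j) h x.

Definition div_weighted_grad gamma u (x : 'rV[R]_(d + s)) : R :=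
  \sum_(i < d + s) partial i (fun y => gamma (lsubmx y) * partial i u y) x.

Definition classical_solution gamma lambda f u : Prop :=
  Ck 2 u /\
  forall x, - div_weighted_grad gamma u x = lambda (lsubmx x) * f (u x).

Definition stable gamma lambda f u : Prop :=
  forall psi : 'rV[R]_(d + s) -> R, C1c psi ->
  (\int[lebesgue_rV R (d + s)]_x
      (lambda (lsubmx x) * derive1 f (u x) * psi x ^+ 2)%:E
   <= \int[lebesgue_rV R (d + s)]_x
      (gamma (lsubmx x) * enorm (grad psi x) ^+ 2)%:E)%E.

(* |grad_{x''} u| *)
Definition norm_grad_r u (x : 'rV[R]_(d + s)) : R := enorm (grad_r u x).

(* The level set of u(x', .) through x'' *)
Definition slice u (x' : 'rV[R]_d) : 'rV[R]_s -> R := fun y => u (row_mx x' y).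

Definition curvature u (x : 'rV[R]_(d + s)) : R :=
  full_curvature (slice u (lsubmx x)) (rsubmx x).

Definition grad_T u h (x : 'rV[R]_(d + s)) : 'rV[R]_s :=
  tangent_proj (slice u (lsubmx x)) (rsubmx x) (grad_r h x).

(* [norm_grad_r u] is only locally Lipschitz, hence differentiable almost
   everywhere; where a partial derivative does not exist, ['D_v] has a default
   value, which does not affect integrals. *)
Definition calS u (x : 'rV[R]_(d + s)) : R :=
  \sum_(j < s) \sum_(i < d)
    `|partial (lshift s i) (partial (rshift d j) u) x| ^+ 2
  - enorm (grad_l (norm_grad_r u) x) ^+ 2.

End weighted_equation.

(* Main.v *)
Require Import Defs.
From HB Require Import structures.
From mathcomp Require Import all_boot all_order all_algebra.
From mathcomp Require Import all_classical all_reals all_analysis.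
From mathcomp Require Import measurable_realfun ring lra.
Import Order.TTheory GRing.Theory Num.Theory.
Import numFieldNormedType.Exports.
Local Open Scope classical_set_scope.
Local Open Scope ring_scope.
Set Implicit Arguments.
Unset Strict Implicit.
Unset Printing Implicit Defensive.

(** Write w = grad_{x''} u, with components w_j for j > d, so that S and the
    curvature term are built from the derivatives of w.

    The weights do not depend on x'', so the equation may be differentiated in
    these variables: each w_j is a weak solution of the linearized equation
      - div (gamma grad w_j) = lambda f'(u) w_j.
    Testing it with w_j phi^2 and summing over j gives
      int gamma phi^2 sum_j |grad w_j|^2 + int gamma phi grad phi . grad |w|^2
        = int lambda f'(u) |w|^2 phi^2,
    and stability, with the test function phi |w|, bounds the right-hand side by
      int gamma phi^2 |grad |w||^2 + int gamma phi grad phi . grad |w|^2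
        + int gamma |w|^2 |grad phi|^2.
    The cross terms cancel, and there remains
      int gamma phi^2 (sum_j |grad w_j|^2 - |grad |w||^2)
        <= int gamma |w|^2 |grad phi|^2.
    The part of the integrand on the left that involves the derivatives in x' is
    S.  The part that involves the derivatives in x'' is nonnegative, and where w
    does not vanish it dominates |w|^2 K^2 + |grad_T |w||^2.

    Three points need care.

    - |w| need not be differentiable where w vanishes, so phi sqrt (|w|^2 + e)
      replaces phi |w| as a test function.  It is of class C^1, its cross term is the
      same for all e > 0 since v grad v = grad |w|^2 / 2 for v = sqrt (|w|^2 + e),
      and |grad v|^2 <= |grad |w||^2 off the zeros of w.  Hence the inequality holds up
      to an error of the form e * c ([stability_eps]), and no limit of integrals is
      needed to get rid of it ([integral_dens_le]).

    - u is only of class C^2, and the equation cannot be differentiated pointwise.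
      But all translates of u in a direction of x'' solve the same equation; the
      derivative at h = 0 of the weak form of the equation for the translate by
      h e_j is the linearized equation ([weak_div_derive],
      [linearized_equation]).

    - The geometric inequality ([curvature_tangential_le]) is linear algebra.  Let
      H be the Hessian of the slice of u through the point, N the unit normal of
      its level set, and P the orthogonal projection onto the tangent space.  On
      the tangent space - P H P / |w| is the shape operator, so Bessel's inequality
      in a basis of principal directions gives |w|^2 K^2 <= |P H P|^2, while
      |P H P|^2 = |H|^2 - 2 |H N|^2 + (H N . N)^2 and grad |w| = H N.

    On the side of integration, everything rests on Fubini's theorem for the
    iterated product that defines Lebesgue measure on R^n: integrals of partial
    derivatives of compactly supported functions vanish ([integral_partial_eq0]),
    and nonnegative functions on R^(d+s) can be integrated in x'' first
    ([ge0_integral_row_mx]). *)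

(** * Integrability on R^n *)

Section box.
Context {R : realType}.

Definition box n (M : R) : set 'rV[R]_n := [set x | forall i, `|x 0 i| <= M].

Definition zero_off_box n (M : R) (g : 'rV[R]_n -> R) :=
  forall x, ~ box M x -> g x = 0.

Lemma compact_box n (M : R) : compact (@box n M).
Proof.
rewrite (_ : box M = [set x : 'rV[R]_n | forall i, `[- M, M]%classic (x 0 i)]).
  by apply: (@rV_compact _ n (fun=> `[- M, M]%classic)) => i; exact: segment_compact.
apply/seteqP; split => x /= h i; have := h i; by rewrite /= in_itv/= ler_norml.
Qed.

Lemma measurable_box n (M : R) : measurable (box M : set (borel_rV R n)).
Proof.
rewrite -[X in measurable X]setCK; apply: measurableC.
apply: sub_sigma_algebra; apply: closed_openC.
by apply: (compact_closed (@norm_hausdorff R _)); exact: compact_box.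
Qed.

Lemma box_fin_measure n (M : R) :
  (lebesgue_rV R n (box M : set (borel_rV R n)) < +oo)%E.
Proof.
elim: n => [|n IH].
  by rewrite /= diracE; case: (_ \in _); rewrite ltry.
rewrite /= /lebesgue_rV_step /pushforward.
rewrite (_ : _ @^-1` _ = `[- M, M]%classic `*` (box M : set (borel_rV R n))).
  rewrite product_measure1E//; last exact: (@measurable_box n M).
  rewrite lte_mul_pinfty//.
  rewrite [X in X \is a fin_num](@lebesgue_measure_itv R `[- M, M])/=.
  by case: ifP => //; rewrite -EFinB.
apply/seteqP; split => -[t y] /=.
  move=> h; split => /=.
    have := h (@lshift 1 n ord0).
    by rewrite /cons_rV /= (@row_mxEl R 1 1 n) mxE /= in_itv/= ler_norml.
  by move=> i; have := h (@rshift 1 n i); rewrite /cons_rV /= (@row_mxEr R 1 1 n).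
move=> [/= + h] i; rewrite in_itv/= -ler_norml => tM.
by case: (@split_ordP 1 n i) => j ->; rewrite /cons_rV /=
   ?(@row_mxEl R 1 1 n) ?(@row_mxEr R 1 1 n) ?mxE.
Qed.

Lemma integrable_zero_off_box n (M C : R) (g : 'rV[R]_n -> R) :
  measurable_fun setT (g : borel_rV R n -> measurableTypeR R) ->
  (forall x, `|g x| <= C) -> zero_off_box M g ->
  (lebesgue_rV R n).-integrable setT (EFin \o g).
Proof.
move=> mg gC g0.
have C0 : 0 <= C by exact: (le_trans (normr_ge0 _) (gC (const_mx 0))).
pose B : set (borel_rV R n) := @box n M.
have : (lebesgue_rV R n).-integrable setT
    (fun x : borel_rV R n => (C * \1_B x)%:E).
  apply/integrableP; split.
    apply/measurable_EFinP; apply: measurable_funM => //.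
    by apply: measurable_indic; exact: (@measurable_box n M).
  rewrite (eq_integral (fun x : borel_rV R n => (C%:E * (\1_B x)%:E)%E)).
    rewrite ge0_integralZl//; last first.
      apply/measurable_EFinP; apply: measurable_indic.
      exact: (@measurable_box n M).
    rewrite integral_indic//; last exact: (@measurable_box n M).
    by rewrite setIT lte_mul_pinfty//; exact: box_fin_measure.
  by move=> x _; rewrite -EFinM /= ger0_norm// mulr_ge0.
move=> iC; apply: (le_integrable measurableT _ _ iC) => //.
  exact/measurable_EFinP.
move=> x _ /=; rewrite lee_fin [leRHS]ger0_norm ?mulr_ge0// indicE.
have [/set_mem xM|/negP xM] := boolP (x \in B); first by rewrite mulr1.
by rewrite g0 ?normr0 ?mulr0 // => /mem_set.
Qed.

Lemma bounded_on_box n (M : R) (g : 'rV[R]_n -> R) : continuous g ->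
  exists2 C, 0 <= C & forall x, box M x -> `|g x| <= C.
Proof.
move=> cg.
have : compact ((fun x => `|g x|) @` (@box n M)).
  apply: continuous_compact; last exact: compact_box.
  apply: continuous_subspaceT => x.
  apply: (@continuous_comp _ _ _ g (fun y => `|y|)); first exact: cg.
  exact: norm_continuous.
move/compact_bounded => [C [_ hC]]; exists (`|C| + 1) => // x xM.
have CC : C < `|C| + 1 by rewrite (le_lt_trans (ler_norm _))// ltrDl.
by have := hC _ CC `|g x|; rewrite /= normr_id; apply; exists x.
Qed.

Lemma integrable_continuous_box n (M : R) (g : 'rV[R]_n -> R) :
  continuous g -> zero_off_box M g ->
  (lebesgue_rV R n).-integrable setT (EFin \o g).
Proof.
move=> cg g0; have [C C0 gC] := bounded_on_box M cg.
apply: (@integrable_zero_off_box n M C) => //.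
  exact: continuous_measurable_borel_rV.
move=> x; have [/gC//|xM] := pselect (box M x).
by rewrite g0// normr0.
Qed.

End box.

(** * Fubini's theorem on R^n *)

Section fubini.
Context {R : realType}.

Definition consv n (t : R) (y : 'rV[R]_n) : 'rV[R]_n.+1 := cons_rV (t, y).

Lemma consv_ord0 n t (y : 'rV[R]_n) : consv t y 0 ord0 = t.
Proof.
have -> : ord0 = @lshift 1 n ord0 by exact/val_inj.
by rewrite /consv /cons_rV (@row_mxEl R 1 1 n) mxE.
Qed.

Lemma consv_lift n t (y : 'rV[R]_n) j : consv t y 0 (lift ord0 j) = y 0 j.
Proof.
have -> : lift ord0 j = @rshift 1 n j by exact/val_inj.
by rewrite /consv /cons_rV (@row_mxEr R 1 1 n).
Qed.

Lemma consv_rowP n t (y : 'rV[R]_n) (x : 'rV[R]_n.+1) :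
  x 0 ord0 = t -> (forall j, x 0 (lift ord0 j) = y 0 j) -> x = consv t y.
Proof.
move=> xt xy; apply/rowP => i.
by case: (unliftP ord0 i) => [j|] ->; rewrite ?consv_lift ?consv_ord0.
Qed.

Lemma ge0_integral_cons n (F : 'rV[R]_n.+1 -> \bar R) :
  measurable_fun setT (F : borel_rV R n.+1 -> \bar R) -> (forall x, 0 <= F x)%E ->
  (\int[lebesgue_rV R n.+1]_x F x =
   \int[lebesgue_measure]_t \int[lebesgue_rV R n]_y F (consv t y))%E.
Proof.
move=> mF F0.
rewrite /= /lebesgue_rV_step ge0_integral_pushforward//; last first.
  exact: measurable_cons_rV.
rewrite preimage_setT fubini_tonelli1//.
exact: measurableT_comp (measurable_cons_rV (n := n)).
by move=> p; exact: F0.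
Qed.

Section integrable.
Variables (n : nat) (F : 'rV[R]_n.+1 -> \bar R).
Hypothesis iF : (lebesgue_rV R n.+1).-integrable setT (F : borel_rV R n.+1 -> \bar R).

Let icF : (lebesgue_measure \x (lebesgue_rV R n))%E.-integrable setT
  ((F : borel_rV R n.+1 -> \bar R) \o @cons_rV R n).
Proof.
move/integrableP : iF => [mF Foo]; apply/integrableP; split.
  exact: measurableT_comp (measurable_cons_rV (n := n)).
move: Foo; rewrite /= /lebesgue_rV_step ge0_integral_pushforward//.
  exact: measurable_cons_rV.
exact: measurableT_comp.
Qed.

Let int_step : (\int[lebesgue_rV R n.+1]_x F x =
  \int[lebesgue_measure \x (lebesgue_rV R n)]_p F (cons_rV p))%E.
Proof.
rewrite /= /lebesgue_rV_step integral_pushforward//.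
- exact: measurable_cons_rV.
- exact: measurable_int iF.
Qed.

Lemma integral_cons12 : (\int[lebesgue_rV R n.+1]_x F x =
   \int[lebesgue_measure]_t \int[lebesgue_rV R n]_y F (consv t y))%E.
Proof. by rewrite int_step -integral12_prod_meas1. Qed.

Lemma integral_cons21 : (\int[lebesgue_rV R n.+1]_x F x =
   \int[lebesgue_rV R n]_y \int[lebesgue_measure]_t F (consv t y))%E.
Proof. by rewrite int_step -integral21_prod_meas1. Qed.

End integrable.

Lemma measurable_row_mx d s : measurable_fun setT
  (fun p : borel_rV R d * borel_rV R s => row_mx p.1 p.2 : borel_rV R (d + s)).
Proof.
apply: measurable_fun_borel_rV => i; case: (split_ordP i) => j ->.
  rewrite (_ : (fun _ => _) =
    (fun x : borel_rV R d => x 0 j : measurableTypeR R) \o fst); last first.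
    by apply/funext => p; rewrite row_mxEl.
  apply: measurableT_comp => //.
  exact: (continuous_measurable_borel_rV (@coord_continuous R 1 d 0 j)).
rewrite (_ : (fun _ => _) =
  (fun x : borel_rV R s => x 0 j : measurableTypeR R) \o snd); last first.
  by apply/funext => p; rewrite row_mxEr.
apply: measurableT_comp => //.
exact: (continuous_measurable_borel_rV (@coord_continuous R 1 s 0 j)).
Qed.

Lemma measurable_cons n t :
  measurable_fun setT (@consv n t : borel_rV R n -> borel_rV R n.+1).
Proof.
apply: (measurableT_comp (measurable_cons_rV (n := n))).
exact: (pair1_measurable (t : measurableTypeR R)).
Qed.

Lemma row_mx_cons d s t (y : 'rV[R]_d) (z : 'rV[R]_s) :
  row_mx (consv t y : 'rV_d.+1) z = consv t (row_mx y z) :> 'rV_(d.+1 + s).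
Proof.
apply: consv_rowP.
  have -> : ord0 = lshift s ord0 :> 'I_(d.+1 + s) by exact/val_inj.
  by rewrite (@row_mxEl R 1 d.+1 s) consv_ord0.
move=> j; case: (@split_ordP d s j) => k ->.
  have -> : lift ord0 (lshift s k) = lshift s (lift ord0 k) :> 'I_(d.+1 + s).
    exact/val_inj.
  by rewrite (@row_mxEl R 1 d.+1 s) consv_lift row_mxEl.
have -> : lift ord0 (rshift d k) = rshift d.+1 k :> 'I_(d.+1 + s) by exact/val_inj.
by rewrite (@row_mxEr R 1 d.+1 s) row_mxEr.
Qed.

(** Tonelli's theorem for R^d * R^s.  By induction on d: peeling off the first
    coordinate is what the definition of [lebesgue_rV] provides. *)
Lemma ge0_integral_row_mx d s (F : 'rV[R]_(d + s) -> \bar R) :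
  measurable_fun setT (F : borel_rV R (d + s) -> \bar R) -> (forall x, 0 <= F x)%E ->
  (\int[lebesgue_rV R (d + s)]_x F x =
   \int[lebesgue_rV R d]_x' \int[lebesgue_rV R s]_x'' F (row_mx x' x''))%E.
Proof.
elim: d F => [|d IH] F mF F0.
  rewrite [RHS](eq_integral (cst (\int[lebesgue_rV R s]_x F x)%E)); last first.
    move=> x' _; apply: eq_integral => x'' _; congr F.
    exact: (@row_thin_mx R 1 s x').
  by rewrite [RHS]integral_dirac// diracT mul1e.
rewrite [LHS](@ge0_integral_cons (d + s))// [RHS]ge0_integral_cons; last 2 first.
- have m2 := measurableT_comp mF (@measurable_row_mx d.+1 s).
  pose f (p : borel_rV R d.+1 * borel_rV R s) := F (row_mx p.1 p.2).
  by apply: (measurable_fun_fubini_tonelli_F f m2 (fun p => F0 _)).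
- by move=> x; exact: integral_ge0.
apply: eq_integral => t _.
have mFt := measurableT_comp mF (@measurable_cons (d + s) t).
apply: (etrans (IH (fun z => F (consv t z)) mFt (fun z => F0 _))).
apply: eq_integral => y _; apply: eq_integral => z _.
by rewrite -row_mx_cons.
Qed.

End fubini.

(** * Integrals of partial derivatives *)

Section derive_along.
Context {R : realType}.

(** Lines, slices, translations, coordinate projections and insertions of a
    coordinate are all affine; this section turns a derivative along the image of
    such a map into a derivative of the composite. *)
Section affine.
Variables (V W : normedModType R) (L : V -> W) (v y : V) (v' : W).
Hypothesis Lv : forall h : R, L (h *: v + y) = h *: v' + L y.

Lemma derive_along (g : W -> R) : 'D_v (g \o L) y = 'D_v' g (L y).
Proof.
rewrite /derive (_ : (fun h : R => h^-1 *:
    (((g \o L) \o shift y) (h *: v) - (g \o L) y)) =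
  (fun h : R => h^-1 *: ((g \o shift (L y)) (h *: v') - g (L y))))//.
by apply/funext => h /=; rewrite Lv.
Qed.

Lemma derivable_along (g : W -> R) : derivable g (L y) v' -> derivable (g \o L) y v.
Proof.
rewrite /derivable => dg.
rewrite (_ : (fun h => _) =
  (fun h => h^-1 *: ((g \o shift (L y)) (h *: v') - g (L y))))//.
by apply/funext => h /=; rewrite Lv.
Qed.

End affine.

Lemma near_off_box n M (x : 'rV[R]_n) : ~ box M x -> \forall y \near x, ~ box M y.
Proof.
move=> xM; have : open (~` (box M : set 'rV[R]_n)).
  apply: closed_openC.
  by apply: (compact_closed (@norm_hausdorff R _)); exact: compact_box.
by rewrite openE; apply.
Qed.

Lemma zero_off_box_derive n M (g : 'rV[R]_n -> R) v : zero_off_box M g ->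
  zero_off_box M ('D_v g).
Proof.
move=> g0 x xM; rewrite (@near_eq_derive _ _ _ _ (cst 0)) ?derive_cst//.
by near do (rewrite /= g0//); exact: near_off_box.
Unshelve. all: by end_near. Qed.

Lemma integral_derive1_eq0 (h : R -> R) M : (forall t, derivable h t 1) ->
  continuous ('D_1 h) -> (forall t, M < `|t| -> h t = 0) ->
  (\int[lebesgue_measure]_t ('D_1 h t)%:E = 0)%E.
Proof.
move=> dh ch h0; pose b := `|M| + 1.
have b0 : 0 < b by rewrite ltr_wpDl.
have bE t : b <= `|t| -> h t = 0.
  move=> bt; apply: h0; rewrite (le_lt_trans (ler_norm M))//.
  by rewrite (lt_le_trans _ bt)// ltrDl.
have D0 t : ~ `[- b, b]%classic t -> 'D_1 h t = 0.
  rewrite /= in_itv /= -ler_norml => /negP; rewrite -ltNge => bt.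
  rewrite (@near_eq_derive _ _ _ _ (cst 0)) ?derive_cst//.
  near=> s; apply: bE; apply: ltW; near: s.
  apply: (cvgr_gt `|t|) => //; exact: norm_continuous.
rewrite (_ : (fun t => _) = (fun t => ('D_1 h t)%:E) \_ `[- b, b]); last first.
  apply/funext => t; rewrite patchE; case: ifPn => // /negP tb.
  by rewrite D0// => /mem_set.
rewrite -integral_mkcond.
rewrite (@continuous_FTC2 _ _ h)//.
- by rewrite !bE ?subee// ?normrN gtr0_norm.
- by rewrite gtrN.
- exact: continuous_subspaceT.
- have hc : continuous h.
    by move=> t; apply: differentiable_continuous; exact/derivable1_diffP.
  by split => [t _||]; [exact: dh|apply/cvg_at_right_filter; exact: hc|
    apply/cvg_at_left_filter; exact: hc].
- by move=> t _; rewrite derive1E.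
Unshelve. all: by end_near. Qed.

Lemma continuous_rV (T : topologicalType) n (f : T -> 'rV[R]_n) :
  (forall i, continuous (fun t => f t 0 i)) -> continuous f.
Proof.
move=> cf t; apply/cvg_ballP => e e0.
have : \forall s \near t, forall i, ball (f t 0 i) e (f s 0 i).
  by apply: filter_forall => i; move: (cf i t) => /cvg_ballP; exact.
by apply: filterS => s fs; split=> // i j; rewrite ord1; exact: fs.
Qed.

Lemma continuous_cons n (t : R) : continuous (@consv R n t).
Proof.
apply: continuous_rV => i; have [k ->|->] := unliftP ord0 i.
  under eq_fun do rewrite consv_lift; exact: coord_continuous.
under eq_fun do rewrite consv_ord0; exact: cst_continuous.
Qed.

Lemma continuous_consl n (y : 'rV[R]_n) : continuous (fun t : R => consv t y).
Proof.
apply: continuous_rV => i; have [k ->|->] := unliftP ord0 i.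
  under eq_fun do rewrite consv_lift; exact: cst_continuous.
by under eq_fun do rewrite consv_ord0; move=> t.
Qed.

Lemma consv_shift n t (y : 'rV[R]_n) j (h : R) :
  consv t (h *: delta_mx 0 j + y) = h *: delta_mx 0 (lift ord0 j) + consv t y.
Proof.
apply/esym/consv_rowP => [|k]; rewrite mxE ?consv_ord0 ?consv_lift !mxE /=.
  by rewrite mulr0 add0r.
by rewrite (inj_eq lift_inj).
Qed.

Lemma consv_shiftl n t (y : 'rV[R]_n) (h : R) :
  consv (h *: 1 + t) y = h *: delta_mx 0 ord0 + consv t y.
Proof.
apply/esym/consv_rowP => [|k]; rewrite mxE ?consv_ord0 ?consv_lift !mxE //=.
by rewrite mulr0 add0r.
Qed.

(** Integrating first in the i-th variable reduces this to the fundamental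
    theorem of calculus on the line.  The first coordinate is reached directly by
    Fubini's theorem, the others by induction on n. *)
Lemma integral_partial_eq0 n (i : 'I_n) (g : 'rV[R]_n -> R) M :
  (forall x, derivable g x (delta_mx 0 i)) -> continuous (partial i g) ->
  zero_off_box M g -> (\int[lebesgue_rV R n]_x (partial i g x)%:E = 0)%E.
Proof.
elim: n i g => [[]//|n IH] i g dg cg g0.
have iF : (lebesgue_rV R n.+1).-integrable setT (EFin \o partial i g).
  by apply: (integrable_continuous_box (M := M)) => //; exact: zero_off_box_derive.
have [j ij|i0] := unliftP ord0 i.
  rewrite integral_cons12//.
  rewrite (eq_integral (cst 0%E)) ?integral0// => t _ /=.
  rewrite -[RHS](IH j (fun y => g (consv t y))).
  - apply: eq_integral => y _; rewrite /partial ij; congr EFin.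
    by rewrite -(derive_along (L := consv t) (consv_shift t y j)).
  - move=> y; apply: (derivable_along (L := consv t) (consv_shift t y j)).
    by rewrite -ij.
  - rewrite (_ : partial j _ = partial i g \o consv t).
      by move=> y; apply: continuous_comp; [exact: continuous_cons|exact: cg].
    apply/funext => y; rewrite /partial ij /=.
    by rewrite -(derive_along (L := consv t) (consv_shift t y j)).
  - by move=> y yM; apply: g0 => h; apply: yM => k; rewrite -(consv_lift t).
rewrite integral_cons21//.
rewrite (eq_integral (cst 0%E)) ?integral0// => y _ /=.
have L := consv_shiftl _ y.
rewrite -[RHS](@integral_derive1_eq0 (fun t => g (consv t y)) M).
- apply: eq_integral => t _; congr EFin; rewrite /partial i0.
  by rewrite -(derive_along (L := fun t => consv t y) (L _)).
- by move=> t; apply: (derivable_along (L := fun t => consv t y) (L t)); rewrite -i0.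
- rewrite (_ : 'D_1 (fun t : R => g (consv t y)) = partial i g \o (fun t => consv t y)).
    by move=> t; apply: continuous_comp; [exact: continuous_consl|exact: cg].
  apply/funext => t; rewrite /partial i0 /=.
  by rewrite -(derive_along (L := fun t => consv t y) (L _)).
- move=> t tM; apply: g0 => /(_ ord0); rewrite consv_ord0.
  by rewrite leNgt tM.
Qed.

(** The integral of a nonnegative function is a supremum over the simple functions
    below it, hence monotone even among nonmeasurable functions.  This makes the
    curvature term, defined through a choice of principal curvatures at each point,
    accessible to estimates. *)
Lemma ge0_le_integral_nonmeas d (T : measurableType d) (mu : {measure set T -> \bar R})
  (D : set T) (f g : T -> \bar R) :
  (forall x, D x -> (0 <= f x)%E) -> (forall x, D x -> (f x <= g x)%E) ->
  (\int[mu]_(x in D) f x <= \int[mu]_(x in D) g x)%E.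
Proof.
move=> f0 fg.
have g0 x : D x -> (0 <= g x)%E by move=> Dx; exact: le_trans (f0 x Dx) (fg x Dx).
rewrite !ge0_integralE//; apply: le_ereal_sup => _ [h hf <-]; exists h => // x.
apply: le_trans (hf x) _; rewrite !patchE; case: ifPn => // /set_mem; exact: fg.
Qed.

End derive_along.

(** * Functions of class C^1 *)

Section calculus.
Context {R : realType}.
Implicit Types (a b u : forall n, 'rV[R]_n -> R).

Lemma Ck1_continuous n (a : 'rV[R]_n -> R) : Ck 1 a -> continuous a.
Proof. by move=> [da _] x; exact: differentiable_continuous. Qed.

Lemma Ck1_partial n (a : 'rV[R]_n -> R) i : Ck 1 a -> continuous (partial i a).
Proof. by move=> [_ ca]; exact: ca. Qed.

Lemma Ck1_derivable n (a : 'rV[R]_n -> R) v x : Ck 1 a -> derivable a x v.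
Proof. by move=> [da _]; exact: diff_derivable. Qed.

Lemma continuousMf (T : topologicalType) (f g : T -> R) :
  continuous f -> continuous g -> continuous (fun x => f x * g x).
Proof. by move=> cf cg x; apply: cvgM; [exact: cf|exact: cg]. Qed.

Lemma continuousDf (T : topologicalType) (f g : T -> R) :
  continuous f -> continuous g -> continuous (fun x => f x + g x).
Proof. by move=> cf cg x; apply: cvgD; [exact: cf|exact: cg]. Qed.

Lemma continuousNf (T : topologicalType) (f : T -> R) :
  continuous f -> continuous (fun x => - f x).
Proof. by move=> cf x; apply: cvgN; exact: cf. Qed.

Lemma continuousXf (T : topologicalType) (f : T -> R) k :
  continuous f -> continuous (fun x => f x ^+ k).
Proof.
move=> cf; elim: k => [|k IH]; first exact: cst_continuous.
by under eq_fun do rewrite exprS; exact: continuousMf.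
Qed.

Lemma continuous_sumf (T : topologicalType) (J : Type) (s : seq J) (F : J -> T -> R) :
  (forall i, continuous (F i)) -> continuous (fun x => \sum_(i <- s) F i x).
Proof.
move=> cF; elim: s => [|i s IH].
  by under eq_fun do rewrite big_nil; exact: cst_continuous.
by under eq_fun do rewrite big_cons; apply: continuousDf.
Qed.

Lemma continuousVf (T : topologicalType) (f : T -> R) :
  (forall x, f x != 0) -> continuous f -> continuous (fun x => (f x)^-1).
Proof. by move=> f0 cf x; apply: cvgV => //; exact: cf. Qed.

Lemma partialM n i (a b : 'rV[R]_n -> R) : Ck 1 a -> Ck 1 b ->
  partial i (fun x => a x * b x) = fun x => partial i a x * b x + a x * partial i b x.
Proof.
move=> ca cb; apply/funext => x; rewrite /partial.
have da := @Ck1_derivable _ _ (delta_mx 0 i) x ca.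
have db := @Ck1_derivable _ _ (delta_mx 0 i) x cb.
rewrite [LHS](deriveM da db).
by rewrite addrC [b x *: _]mulrC.
Qed.

Lemma Ck1M n (a b : 'rV[R]_n -> R) : Ck 1 a -> Ck 1 b -> Ck 1 (fun x => a x * b x).
Proof.
move=> ca cb; split=> [x|i].
  by apply: differentiableM; [exact: ca.1|exact: cb.1].
by rewrite (partialM i ca cb); apply: continuousDf; apply: continuousMf;
  (exact: Ck1_continuous || exact: Ck1_partial).
Qed.

Lemma partialD n i (a b : 'rV[R]_n -> R) : Ck 1 a -> Ck 1 b ->
  partial i (fun x => a x + b x) = fun x => partial i a x + partial i b x.
Proof.
move=> ca cb; apply/funext => x; rewrite /partial.
have da := @Ck1_derivable _ _ (delta_mx 0 i) x ca.
exact: (deriveD da (@Ck1_derivable _ _ (delta_mx 0 i) x cb)).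
Qed.

Lemma Ck1D n (a b : 'rV[R]_n -> R) : Ck 1 a -> Ck 1 b -> Ck 1 (fun x => a x + b x).
Proof.
move=> ca cb; split=> [x|i].
  by apply: differentiableD; [exact: ca.1|exact: cb.1].
by rewrite partialD//; apply: continuousDf; exact: Ck1_partial.
Qed.

Lemma partial_cst n i (k : R) : partial i (fun _ : 'rV[R]_n => k) = fun=> 0.
Proof. by apply/funext => x; exact: derive_cst. Qed.

Lemma Ck1_cst n (k : R) : Ck 1 (fun _ : 'rV[R]_n => k).
Proof.
split=> [x|i]; first exact: differentiable_cst.
by rewrite partial_cst; exact: cst_continuous.
Qed.

Lemma Ck1_sum n (J : Type) (s : seq J) (F : J -> 'rV[R]_n -> R) :
  (forall k, Ck 1 (F k)) -> Ck 1 (fun x => \sum_(k <- s) F k x).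
Proof.
move=> cF; elim: s => [|k s IH].
  by under eq_fun do rewrite big_nil; exact: Ck1_cst.
by under eq_fun do rewrite big_cons; exact: Ck1D.
Qed.

Lemma partial_sum n i (J : Type) (s : seq J) (F : J -> 'rV[R]_n -> R) :
  (forall k, Ck 1 (F k)) ->
  partial i (fun x => \sum_(k <- s) F k x) = fun x => \sum_(k <- s) partial i (F k) x.
Proof.
move=> cF; elim: s => [|k s IH].
  under [in RHS]eq_fun do rewrite big_nil; rewrite -(partial_cst i 0).
  by congr (partial i _); apply/funext => x; rewrite big_nil.
under [in RHS]eq_fun do rewrite big_cons.
rewrite [RHS](_ : _ = fun x => partial i (F k) x +
  partial i (fun x => \sum_(k <- s) F k x) x); last by rewrite IH.
rewrite -partialD//; last exact: Ck1_sum.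
by congr (partial i _); apply/funext => x; exact: big_cons.
Qed.

Lemma diff_compR n (F : R -> R) (a : 'rV[R]_n -> R) x v :
  derivable F (a x) 1 -> differentiable a x ->
  differentiable (F \o a) x /\ 'D_v (F \o a) x = derive1 F (a x) * 'D_v a x.
Proof.
move=> dF da; have dF' : differentiable F (a x) by exact/derivable1_diffP.
have dFa := differentiable_comp da dF'; split=> //.
by rewrite !deriveE// diff_comp//= deriv1E// mulrC.
Qed.

Lemma partial_comp n i (F : R -> R) (a : 'rV[R]_n -> R) :
  (forall t, derivable F t 1) -> Ck 1 a ->
  partial i (fun x => F (a x)) = fun x => derive1 F (a x) * partial i a x.
Proof.
move=> dF ca; apply/funext => x.
exact: (diff_compR _ (dF _) (ca.1 x)).2.
Qed.

Lemma Ck1_comp n (F : R -> R) (a : 'rV[R]_n -> R) : C1_real F -> Ck 1 a ->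
  Ck 1 (fun x => F (a x)).
Proof.
move=> [dF cF] ca; split=> [x|i].
  exact: (diff_compR 0 (dF _) (ca.1 x)).1.
rewrite partial_comp//; apply: continuousMf; last exact: Ck1_partial.
by move=> x; apply: continuous_comp; [exact: Ck1_continuous|exact: cF].
Qed.

Lemma sqrt_derivable (t : R) : 0 < t -> derivable Num.sqrt t 1.
Proof. by move=> t0; have [] := is_derive1_sqrt t0. Qed.

Lemma partial_sqrt n i (a : 'rV[R]_n -> R) x : differentiable a x -> 0 < a x ->
  partial i (fun x => Num.sqrt (a x)) x = (2 * Num.sqrt (a x))^-1 * partial i a x.
Proof.
move=> da a0; rewrite /partial (diff_compR _ (sqrt_derivable a0) da).2.
by rewrite derive1E derive_sqrt.
Qed.

Lemma Ck1_sqrt n (a : 'rV[R]_n -> R) : Ck 1 a -> (forall x, 0 < a x) ->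
  Ck 1 (fun x => Num.sqrt (a x)).
Proof.
move=> ca a0; split=> [x|i].
  exact: (diff_compR 0 (sqrt_derivable (a0 x)) (ca.1 x)).1.
rewrite (_ : partial i _ =
  fun x => (2 * Num.sqrt (a x))^-1 * partial i a x); last first.
  by apply/funext => x; rewrite partial_sqrt//; exact: ca.1.
apply: continuousMf; last exact: Ck1_partial.
apply: continuousVf => [x|]; first by rewrite mulf_neq0// gt_eqF// sqrtr_gt0.
apply: continuousMf; first exact: cst_continuous.
move=> x; apply: (continuous_comp (g := Num.sqrt)).
  exact: Ck1_continuous.
exact: sqrt_continuous.
Qed.

Section lsubmx.
Variables d s : nat.

Lemma partial_lsubmxl i (g : 'rV[R]_d -> R) :
  partial (lshift s i) (fun x => g (lsubmx x)) = fun x => partial i g (lsubmx x).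
Proof.
apply/funext => x; apply: (derive_along (L := fun x : 'rV[R]_(d + s) => lsubmx x)) => h.
by apply/rowP => k; rewrite !mxE; congr (_ * _ + _).
Qed.

Lemma partial_lsubmxr j (g : 'rV[R]_d -> R) :
  partial (rshift d j) (fun x : 'rV[R]_(d + s) => g (lsubmx x)) = fun=> 0.
Proof.
apply/funext => x; rewrite -[RHS](derive0 g (lsubmx x)).
apply: (derive_along (L := fun x : 'rV[R]_(d + s) => lsubmx x)) => h.
by apply/rowP => k; rewrite !mxE eq_lrshift /= !mulr0.
Qed.

Lemma Ck1_lsubmx (g : 'rV[R]_d -> R) : Ck 1 g ->
  Ck 1 (fun x : 'rV[R]_(d + s) => g (lsubmx x)).
Proof.
move=> cg; split=> [x|i].
  apply: (@differentiable_comp _ _ _ _ lsubmx g); last exact: cg.1.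
  exact: differentiable_lsubmx.
case: (split_ordP i) => k ->; last by rewrite partial_lsubmxr; exact: cst_continuous.
rewrite partial_lsubmxl => x; apply: (@continuous_comp _ _ _ lsubmx (partial k g)).
  by apply: differentiable_continuous; exact: differentiable_lsubmx.
exact: (@Ck1_partial _ g k cg (lsubmx x)).
Qed.

End lsubmx.
End calculus.

(** * Symmetry of second derivatives *)

Section schwarz.
Context {R : realType} (n : nat).
Implicit Types (u : 'rV[R]_n -> R) (p q x y : 'rV[R]_n) (s t h : R).

Lemma derive_line u x p t : derivable u (x + t *: p) p ->
  is_derive t 1 (fun t => u (x + t *: p)) ('D_p u (x + t *: p)).
Proof.
have L (h : R) : x + (h *: 1 + t) *: p = h *: p + (x + t *: p).
  by rewrite scalerDl addrCA [h *: 1]mulr1.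
move=> du; apply: DeriveDef.
  exact: (derivable_along (L := fun t : R => x + t *: p) L du).
exact: (derive_along (L := fun t : R => x + t *: p) L).
Qed.

Lemma MVT_line u x p h : (forall y, derivable u y p) -> 0 < h ->
  exists2 t, 0 < t < h & u (x + h *: p) - u x = 'D_p u (x + t *: p) * h.
Proof.
move=> du h0.
have dl t : is_derive t 1 (fun t => u (x + t *: p)) ('D_p u (x + t *: p)).
  exact: derive_line.
have cl : {within `[0, h], continuous (fun t => u (x + t *: p))}.
  by apply: derivable_within_continuous => t _; have [] := dl t.
have [t + ut] := MVT h0 (fun t _ => dl t) cl.
rewrite in_itv /= => t0h; exists t => //.
by move: ut; rewrite scale0r addr0 subr0.
Qed.

(** The left-hand side is symmetric in p and q, which is what makes the two mixed
    derivatives agree. *)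
Lemma second_difference u x p q h : (forall y, derivable u y p) ->
  (forall y, derivable ('D_p u) y q) -> 0 < h ->
  exists s t, [/\ 0 < s < h, 0 < t < h &
    u (x + h *: p + h *: q) - u (x + h *: p) - (u (x + h *: q) - u x) =
    'D_q ('D_p u) (x + s *: p + t *: q) * h * h].
Proof.
move=> du ddu h0.
pose g y := u (y + h *: q) - u y.
have L y (k : R) : (k *: p + y) + h *: q = k *: p + (y + h *: q) by rewrite addrA.
have dgq y : derivable (fun y => u (y + h *: q)) y p.
  exact: (derivable_along (L := fun y => y + h *: q) (L y)).
have dg y : derivable g y p by exact: derivableB.
have Dg y : 'D_p g y = 'D_p u (y + h *: q) - 'D_p u y.
  rewrite [LHS](deriveB (dgq y) (du y)); congr (_ - _).
  exact: (derive_along (L := fun y => y + h *: q) (L y)).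
have [s s0 gs] := MVT_line x dg h0.
have [t t0 gt] := MVT_line (x + s *: p) ddu h0.
exists s, t; split => //; rewrite -gt -Dg -gs /g.
by rewrite [x + _ + _]addrAC.
Qed.

(** By [second_difference], for every small h the two mixed derivatives take a
    common value at two points at distance O(h) from x; continuity concludes. *)
Lemma derive_comm u p q :
  (forall y, derivable u y p) -> (forall y, derivable u y q) ->
  (forall y, derivable ('D_p u) y q) -> (forall y, derivable ('D_q u) y p) ->
  continuous ('D_q ('D_p u)) -> continuous ('D_p ('D_q u)) ->
  'D_q ('D_p u) = 'D_p ('D_q u).
Proof.
move=> dp dq dpq dqp cpq cqp; apply/funext => x.
apply/eqP/negPn/negP => neq.
pose e := `|'D_q ('D_p u) x - 'D_p ('D_q u) x| / 2.
have e0 : 0 < e by rewrite divr_gt0// normr_gt0 subr_eq0.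
have near_line (F : 'rV[R]_n -> R) p' q' : continuous F -> exists2 h0, 0 < h0 &
    forall h s t, 0 < h < h0 -> 0 < s < h -> 0 < t < h ->
    `|F x - F (x + s *: p' + t *: q')| < e.
  move=> cF; have /nbhs_ballP[r r0 xr] : \forall y \near x, `|F x - F y| < e.
    by move: (cF x) => /cvgrPdist_lt; exact.
  pose k := `|p'| + `|q'| + 1.
  have k0 : 0 < k by rewrite ltr_wpDl// addr_ge0.
  exists (r / k); first by rewrite divr_gt0.
  move=> h s t /andP[h0 hk] /andP[s0 sh] /andP[t0 th]; apply: xr.
  rewrite -ball_normE /= -addrA opprD addNKr normrN.
  rewrite (le_lt_trans (ler_normD _ _))// !normrZ !gtr0_norm//.
  rewrite (@lt_trans _ _ (h * k))// -?ltr_pdivlMr//.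
  by rewrite /k 2!mulrDr mulr1 -[ltLHS]addr0 ler_ltD// lerD// ler_wpM2r// ltW.
have [a a0 near1] := near_line _ p q cpq.
have [b b0 near2] := near_line _ q p cqp.
pose h := Num.min a b / 2.
have ab0 : 0 < Num.min a b by rewrite lt_min a0.
have h0 : 0 < h by rewrite divr_gt0.
have hab : h < Num.min a b by rewrite ltr_pdivrMr// ltr_pMr// ltr1n.
have ha : 0 < h < a by rewrite h0 (lt_le_trans hab)// ge_min lexx.
have hb : 0 < h < b by rewrite h0 (lt_le_trans hab)// ge_min lexx orbT.
have [s [t [sh th E1]]] := second_difference x dp dpq h0.
have [s' [t' [sh' th' E2]]] := second_difference x dq dqp h0.
have := near1 _ _ _ ha sh th; have := near2 _ _ _ hb sh' th'.
have tri (k1 k2 k3 k : R) : `|k1 - k3| < k -> `|k2 - k3| < k -> `|k1 - k2| < k + k.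
  move=> k13; rewrite distrC => k23.
  exact: le_lt_trans (ler_distD k3 _ _) (ltrD k13 k23).
have swap (k1 k2 k3 k4 : R) : k1 - k2 - (k3 - k4) = k1 - k3 - (k2 - k4) by ring.
have -> : 'D_q ('D_p u) (x + s *: p + t *: q) = 'D_p ('D_q u) (x + s' *: q + t' *: p).
  apply: (mulIf (lt0r_neq0 h0)); apply: (mulIf (lt0r_neq0 h0)).
  apply: (etrans (esym E1)); apply: etrans E2.
  by rewrite [x + h *: q + h *: p]addrAC; exact: swap.
move=> BC AC; have := tri _ _ _ _ AC BC.
by rewrite -splitr ltxx.
Qed.

End schwarz.

(** * Weak form of a divergence equation *)

Section integral_by_parts.
Context {R : realType} (n : nat).
Implicit Types (a b psi : 'rV[R]_n -> R) (M : R).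

Definition int_rV a : R := (\int[lebesgue_rV R n]_x a x)%R.

Definition cont_box M a := continuous a /\ zero_off_box M a.

Lemma cont_box_integrable M a : cont_box M a ->
  (lebesgue_rV R n).-integrable setT (EFin \o a).
Proof. by move=> [ca a0]; exact: integrable_continuous_box ca a0. Qed.

Lemma EFin_int_rV M a : cont_box M a ->
  (\int[lebesgue_rV R n]_x (a x)%:E = (int_rV a)%:E)%E.
Proof.
move=> ca; rewrite /int_rV /Rintegral fineK//.
exact: (integrable_fin_num measurableT (cont_box_integrable ca)).
Qed.

Lemma int_rVD M a b : cont_box M a -> cont_box M b ->
  int_rV (fun x => a x + b x) = int_rV a + int_rV b.
Proof.
move=> ca cb; have ib := cont_box_integrable cb.
exact: RintegralD measurableT (cont_box_integrable ca) ib.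
Qed.

Lemma int_rVB M a b : cont_box M a -> cont_box M b ->
  int_rV (fun x => a x - b x) = int_rV a - int_rV b.
Proof.
move=> ca cb; have ib := cont_box_integrable cb.
exact: RintegralB measurableT (cont_box_integrable ca) ib.
Qed.

Lemma int_rVZ M k a : cont_box M a -> int_rV (fun x => k * a x) = k * int_rV a.
Proof. by move=> ca; exact: RintegralZl measurableT (cont_box_integrable ca). Qed.

Lemma cont_boxMl M a b : continuous a -> cont_box M b ->
  cont_box M (fun x => a x * b x).
Proof.
move=> ca [cb b0]; split; first exact: continuousMf.
by move=> x xM; rewrite b0 ?mulr0.
Qed.

Lemma cont_boxD M a b : cont_box M a -> cont_box M b -> cont_box M (fun x => a x + b x).
Proof.
move=> [ca a0] [cb b0]; split; first exact: continuousDf.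
by move=> x xM; rewrite a0// b0// addr0.
Qed.

Lemma cont_boxN M a : cont_box M a -> cont_box M (fun x => - a x).
Proof.
move=> [ca a0]; split; first exact: continuousNf.
by move=> x xM; rewrite a0// oppr0.
Qed.

Lemma cont_box_sum M (J : Type) (s : seq J) (F : J -> 'rV[R]_n -> R) :
  (forall k, cont_box M (F k)) -> cont_box M (fun x => \sum_(k <- s) F k x).
Proof.
move=> cF; split; first by apply: continuous_sumf => k; exact: (cF k).1.
by move=> x xM; apply: big1 => k _; exact: (cF k).2.
Qed.

Lemma int_rV_sum M (J : Type) (s : seq J) (F : J -> 'rV[R]_n -> R) :
  (forall k, cont_box M (F k)) ->
  int_rV (fun x => \sum_(k <- s) F k x) = \sum_(k <- s) int_rV (F k).
Proof.
move=> cF; elim: s => [|k s IH].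
  by rewrite big_nil /int_rV /Rintegral integral0_eq// => x _; rewrite big_nil.
rewrite big_cons -IH -(int_rVD (cF k) (cont_box_sum s cF)); congr int_rV.
by apply/funext => x; rewrite big_cons.
Qed.

Lemma cont_box_partial M i psi : Ck 1 psi -> zero_off_box M psi ->
  cont_box M (partial i psi).
Proof.
move=> cp p0; split; first exact: Ck1_partial.
exact: zero_off_box_derive.
Qed.

Lemma int_rV_partial_eq0 M i a : Ck 1 a -> zero_off_box M a -> int_rV (partial i a) = 0.
Proof.
move=> ca a0; rewrite /int_rV /Rintegral (integral_partial_eq0 _ _ a0)//.
- by move=> x; exact: Ck1_derivable.
- exact: Ck1_partial.
Qed.

Lemma integration_by_parts M i a psi : Ck 1 a -> Ck 1 psi -> zero_off_box M psi ->
  int_rV (fun x => a x * partial i psi x) = - int_rV (fun x => partial i a x * psi x).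
Proof.
move=> ca cp p0; apply/eqP; rewrite -addr_eq0 addrC.
have cpsi : cont_box M psi by split => //; exact: Ck1_continuous.
rewrite -(@int_rVD M).
- rewrite -(partialM i ca cp) (@int_rV_partial_eq0 M)//; first exact: Ck1M.
  by move=> x xM; rewrite p0// mulr0.
- by apply: cont_boxMl => //; exact: Ck1_partial.
- by apply: cont_boxMl; [exact: Ck1_continuous|exact: cont_box_partial].
Qed.

Lemma box_shift M e h x : `|h| <= 1 -> box M x ->
  box (M + `|e|) (h *: e + x : 'rV[R]_n).
Proof.
move=> h1 xM i; rewrite !mxE addrC (le_trans (ler_normD _ _))// lerD// normrM.
have ei : `|e 0 i| <= `|e|.
  by rewrite [leRHS]/Num.Def.normr/= mx_normrE; exact: (le_bigmax _ _ (0, i)).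
by rewrite (le_trans (ler_wpM2r (normr_ge0 _) h1))// mul1r.
Qed.

(** For |h| <= 1 the integrand and its derivative in h vanish off a fixed box, and
    the latter is bounded there by a constant: this is the domination required for
    differentiating under the integral sign. *)
Lemma is_derive_int_shift M a b e : (forall x, derivable a x e) -> continuous a ->
  continuous ('D_e a) -> cont_box M b ->
  is_derive (0 : R) 1 (fun h : R => int_rV (fun x => a (h *: e + x) * b x))
    (int_rV (fun x => 'D_e a x * b x)).
Proof.
move=> da ca cda cb.
pose f (h : R) (x : borel_rV R n) : R := a (h *: e + x) * b x.
have shiftc h : continuous (fun x : 'rV[R]_n => h *: e + x).
  by apply: continuous_rV => i; under eq_fun do rewrite mxE;
     apply: continuousDf; [exact: cst_continuous|exact: coord_continuous].
have L (x : 'rV[R]_n) (t k : R) : (k *: 1 + t) *: e + x = k *: e + (t *: e + x).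
  by rewrite scalerDl addrA [k *: 1]mulr1.
have df (t : R) x : derivable (fun h : R => f h x) t 1.
  apply: derivableM => //.
  exact: (derivable_along (L := fun h : R => h *: e + x) (L x t) (da _)).
have Df (t : R) x : partial1of2 f t x = 'D_e a (t *: e + x) * b x.
  have dl := derivable_along (L := fun h : R => h *: e + x) (L x t) (da _).
  rewrite partial1of2E; apply: (etrans (deriveMr (b x) dl)); rewrite mulrC.
  apply: (congr1 (fun k => k * b x)).
  exact: (derive_along (L := fun h : R => h *: e + x) (L x t)).
have [C1 C10 hC1] := bounded_on_box (M + `|e|) cda.
have [C2 C20 hC2] := bounded_on_box M cb.1.
pose G (x : borel_rV R n) : R := C1 * C2 * \1_(@box R n M : set (borel_rV R n)) x.
have intf t : (lebesgue_rV R n).-integrable setT (EFin \o f t).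
  apply: (@cont_box_integrable M); apply: cont_boxMl cb.
  move=> x; apply: (@continuous_comp _ _ _ (fun x => t *: e + x) a).
    exact: shiftc.
  exact: ca.
have G0 x : 0 <= G x by rewrite !mulr_ge0.
have iG : (lebesgue_rV R n).-integrable setT (EFin \o G).
  apply: (@integrable_zero_off_box _ n M (C1 * C2)).
  - apply: measurable_funM => //; apply: measurable_indic.
    exact: (@measurable_box R n M).
  - move=> x; rewrite ger0_norm // /G indicE; case: (_ \in _); rewrite ?mulr1 ?mulr0//.
    exact: mulr_ge0.
  - by move=> x xM; rewrite /G indicE memNset// mulr0.
have Gub t x : `]-1, 1[%classic t -> setT x -> `|partial1of2 f t x| <= G x.
  rewrite /= in_itv /= -ltr_norml => t1 _; rewrite Df normrM /G indicE.
  have [/set_mem xM|/negP xM] := boolP (x \in (@box R n M)).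
    rewrite mulr1 ler_pM// ?hC2//; apply: hC1; apply: box_shift => //; exact: ltW.
  rewrite (cb.2 x) ?normr0 ?mulr0// => xM'; by apply: xM; exact/mem_set.
have I0 : `]-1, 1[%classic (0 : R) by rewrite /= in_itv /= ltrN10 ltr01.
have d1 := @derivable_under_integral R _ _ (lebesgue_rV R n) f setT
  measurableT 0 (-1) 1 I0
  (fun t _ => intf t) (fun t x _ _ => df t x) G G0 iG Gub.
have d2 := @differentiation_under_integral R _ _ (lebesgue_rV R n) f setT
  measurableT 0 (-1) 1 I0
  (fun t _ => intf t) (fun t x _ _ => df t x) G G0 iG Gub.
apply: DeriveDef => //; rewrite -derive1E [LHS]d2.
by apply: eq_Rintegral => x _; rewrite Df scale0r add0r.
Qed.

Lemma partial_shift i a (c : 'rV[R]_n) :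
  partial i (fun x => a (c + x)) = fun x => partial i a (c + x).
Proof.
apply/funext => x; apply: (derive_along (L := fun x : 'rV[R]_n => c + x)) => h.
exact: addrCA.
Qed.

Lemma Ck1_shift a (c : 'rV[R]_n) : Ck 1 a -> Ck 1 (fun x => a (c + x)).
Proof.
move=> ca.
have dc x : differentiable (fun x : 'rV[R]_n => c + x) x.
  by apply: differentiableD; [exact: differentiable_cst|exact: ex_diff].
split=> [x|i].
  by apply: (@differentiable_comp _ _ _ _ (fun x => c + x) a) => //; exact: ca.1.
rewrite partial_shift => x.
apply: (@continuous_comp _ _ _ (fun x : 'rV[R]_n => c + x) (partial i a)).
  exact: differentiable_continuous.
exact: (@Ck1_partial _ _ a i ca (c + x)).
Qed.

(** The translates of a and F by h e satisfy the same equation, hence its weak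
    form; the claim is the derivative at h = 0 of this identity.  No second
    derivative of a enters, which is why a solution of class C^2 can be
    linearized. *)
Lemma weak_div_derive M (a : 'I_n -> 'rV[R]_n -> R) F psi e :
  (forall i, Ck 1 (a i)) -> Ck 1 F -> (forall i, continuous ('D_e (a i))) ->
  continuous ('D_e F) ->
  (forall x, - \sum_i partial i (a i) x = F x) ->
  Ck 1 psi -> zero_off_box M psi ->
  int_rV (fun x => \sum_i 'D_e (a i) x * partial i psi x) =
  int_rV (fun x => 'D_e F x * psi x).
Proof.
move=> ca cF cDa cDF aF cp p0.
have ccp i : cont_box M (partial i psi) by exact: cont_box_partial.
have cpsi : cont_box M psi by split => //; exact: Ck1_continuous.
have weak h : \sum_i int_rV (fun x => a i (h *: e + x) * partial i psi x) =
              int_rV (fun x => F (h *: e + x) * psi x).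
  have cs i : Ck 1 (fun x => a i (h *: e + x)) by exact: Ck1_shift.
  rewrite (eq_bigr (fun i =>
      -1 * int_rV (fun x => partial i (a i) (h *: e + x) * psi x))).
    have cDs i : cont_box M (fun x => partial i (a i) (h *: e + x) * psi x).
      apply: cont_boxMl => //.
      by have := @Ck1_partial _ _ _ i (cs i); rewrite partial_shift.
    rewrite -mulr_sumr -(int_rV_sum _ cDs) -(int_rVZ _ (cont_box_sum _ cDs)).
    by congr int_rV; apply/funext => x; rewrite -mulr_suml mulN1r -mulNr aF.
  by move=> i _; rewrite (integration_by_parts i (cs i) cp p0) partial_shift mulN1r.
have dsum : is_derive (0 : R) 1
    (fun h : R => \sum_i int_rV (fun x => a i (h *: e + x) * partial i psi x))
    (\sum_i int_rV (fun x => 'D_e (a i) x * partial i psi x)).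
  rewrite (_ : (fun h : R => _) = \sum_i (fun h : R =>
      int_rV (fun x => a i (h *: e + x) * partial i psi x))).
    apply: is_derive_sum => i; apply: is_derive_int_shift (ccp i) => //.
      by move=> x; exact: Ck1_derivable.
    exact: Ck1_continuous.
  by apply/funext => h; rewrite fct_sumE.
have dF : is_derive (0 : R) 1 (fun h : R => int_rV (fun x => F (h *: e + x) * psi x))
    (int_rV (fun x => 'D_e F x * psi x)).
  apply: is_derive_int_shift cpsi => //.
    by move=> x; exact: Ck1_derivable.
  exact: Ck1_continuous.
rewrite (int_rV_sum (M := M)); last by move=> i; exact: cont_boxMl.
move: dsum; rewrite (_ : (fun h : R => \sum_i _) =
    fun h : R => int_rV (fun x => F (h *: e + x) * psi x)); last exact/funext.
by move=> [_ <-]; case: dF.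
Qed.

End integral_by_parts.

(** * Tangential part of a symmetric matrix *)

Section linear_algebra.
Context {R : realType}.

Lemma dotE n (v w : 'rV[R]_n) : dot v w = (v *m w^T) 0 0.
Proof. by rewrite mxE; apply: eq_bigr => i _; rewrite !mxE. Qed.

Lemma dotC n (v w : 'rV[R]_n) : dot v w = dot w v.
Proof. by apply: eq_bigr => i _; rewrite mulrC. Qed.

Lemma dotBZl n (v w z : 'rV[R]_n) k : dot (v - k *: w) z = dot v z - k * dot w z.
Proof.
rewrite /dot mulr_sumr -sumrB; apply: eq_bigr => i _; rewrite !mxE; ring.
Qed.

Lemma dotZl n (v w : 'rV[R]_n) k : dot (k *: v) w = k * dot v w.
Proof. by rewrite /dot mulr_sumr; apply: eq_bigr => i _; rewrite mxE mulrA. Qed.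

Lemma dot_ge0 n (v : 'rV[R]_n) : 0 <= dot v v.
Proof. by apply: sumr_ge0 => i _; rewrite -expr2 sqr_ge0. Qed.

Lemma enorm_sqr n (v : 'rV[R]_n) : enorm v ^+ 2 = dot v v.
Proof. by rewrite sqr_sqrtr// dot_ge0. Qed.

Lemma dot_eq0 n (v : 'rV[R]_n) : (dot v v == 0) = (v == 0).
Proof.
apply/eqP/eqP => [v0|->]; last by rewrite /dot big1// => i _; rewrite mxE mul0r.
apply/rowP => i; rewrite mxE; apply/eqP; rewrite -sqrf_eq0 expr2.
by move/eqP: v0; rewrite psumr_eq0; [move/allP => /(_ i); rewrite mem_index_enum; exact|
  move=> k _; rewrite -expr2 sqr_ge0].
Qed.

(** The squared Frobenius norm: as a trace it is invariant under cyclic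
    permutations, which is how it is computed below. *)
Definition frob m n (A : 'M[R]_(m, n)) : R := \tr (A *m A^T).

Lemma frobE m n (A : 'M[R]_(m, n)) : frob A = \sum_i \sum_j A i j ^+ 2.
Proof.
by apply: eq_bigr => i _; rewrite !mxE; apply: eq_bigr => j _; rewrite mxE expr2.
Qed.

Lemma frob_ge0 m n (A : 'M[R]_(m, n)) : 0 <= frob A.
Proof. by rewrite frobE; do 2!(apply: sumr_ge0 => ? _); rewrite sqr_ge0. Qed.

Lemma frob_row m n (A : 'M[R]_(m, n)) : frob A = \sum_i dot (row i A) (row i A).
Proof.
by rewrite frobE; apply: eq_bigr => i _; apply: eq_bigr => j _; rewrite !mxE expr2.
Qed.

Lemma trace11 (A : 'M[R]_1) : \tr A = A 0 0.
Proof. by rewrite /mxtrace big_ord1. Qed.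

(** Bessel's inequality for each column of B, the rows of E being orthonormal:
    the difference is the squared norm of F *m B, where F projects onto the
    orthogonal complement of these rows. *)
Lemma frob_bessel m n k (E : 'M[R]_(m, n)) (B : 'M[R]_(n, k)) :
  E *m E^T = 1%:M -> frob (E *m B) <= frob B.
Proof.
move=> EE; pose F : 'M[R]_n := 1%:M - E^T *m E.
have FT : F^T = F by rewrite /F linearB/= trmx1 trmx_mul trmxK.
have FF : F *m F = F.
  rewrite {2}/F mulmxBr mulmx1 /F mulmxBl mul1mx.
  by rewrite -mulmxA [E *m _]mulmxA EE mul1mx subrr subr0.
have : frob (F *m B) = frob B - frob (E *m B).
  rewrite /frob !trmx_mul FT mulmxA -(mulmxA F) mxtrace_mulC !mulmxA FF.
  rewrite /F mulmxBl mul1mx mulmxBl linearB /=; congr (_ - _).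
  by rewrite -!mulmxA [LHS]mxtrace_mulC !mulmxA.
by move=> FB; rewrite -subr_ge0 -FB frob_ge0.
Qed.

(** By the convention on division the left-hand side is 0 when all a j vanish. *)
Lemma cauchy_schwarz (J : finType) (a b : J -> R) :
  (\sum_j a j * b j) ^+ 2 / (\sum_j a j * a j) <= \sum_j b j ^+ 2.
Proof.
set t := \sum_j a j * b j; set c := \sum_j a j * a j.
have [->|c0] := eqVneq c 0.
  by rewrite invr0 mulr0 sumr_ge0// => j _; rewrite sqr_ge0.
have : 0 <= \sum_j (b j - t / c * a j) ^+ 2 by apply: sumr_ge0 => j _; rewrite sqr_ge0.
rewrite (eq_bigr (fun j => b j ^+ 2 - 2 * (t / c) * (a j * b j) +
    (t / c) ^+ 2 * (a j * a j))); last by move=> j _; ring.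
rewrite big_split /= sumrB -!mulr_sumr -/t -/c -[_ / _ <= _]subr_ge0.
rewrite (_ : \sum_j b j ^+ 2 - t ^+ 2 / c =
  \sum_j b j ^+ 2 - 2 * (t / c) * t + (t / c) ^+ 2 * c)//.
by field.
Qed.

Section projection.
Variables (n : nat) (N : 'rV[R]_n) (H : 'M[R]_n).
Hypothesis N1 : dot N N = 1.
Hypothesis HT : H^T = H.

(** Vectors being rows, this projects onto the hyperplane orthogonal to N by
    multiplication on the right. *)
Definition tproj : 'M[R]_n := 1%:M - N^T *m N.

Let NN : N *m N^T = 1%:M.
Proof. by apply/matrixP => i j; rewrite !ord1 -dotE N1 mxE. Qed.

Lemma mul_tproj (v : 'rV[R]_n) : v *m tproj = v - dot v N *: N.
Proof.
rewrite mulmxBr mulmx1 mulmxA; congr (_ - _).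
by rewrite [v *m N^T]mx11_scalar -dotE mul_scalar_mx.
Qed.

Lemma tproj_idem : tproj *m tproj = tproj.
Proof.
rewrite {2}/tproj mulmxBr mulmx1 /tproj mulmxBl mul1mx.
by rewrite -mulmxA [N *m _]mulmxA NN mul1mx subrr subr0.
Qed.

Lemma tproj_tr : tproj^T = tproj.
Proof. by rewrite /tproj linearB/= trmx1 trmx_mul trmxK. Qed.

Lemma dot_mul_tproj (v : 'rV[R]_n) :
  dot (v *m tproj) (v *m tproj) = dot v v - dot v N ^+ 2.
Proof.
rewrite dotE trmx_mul tproj_tr mulmxA -(mulmxA v) tproj_idem mul_tproj -dotE.
by rewrite dotBZl [dot N v]dotC expr2.
Qed.

Lemma frob_tproj : frob (tproj *m H *m tproj) =
  frob H - dot (N *m H) (N *m H) *+ 2 + dot (N *m H) N ^+ 2.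
Proof.
pose v := N *m H.
have PH : tproj *m H = H - N^T *m v by rewrite /tproj mulmxBl mul1mx mulmxA.
have vT : v^T = H *m N^T by rewrite trmx_mul HT.
rewrite /frob !trmx_mul HT tproj_tr !mulmxA -(mulmxA _ tproj tproj) tproj_idem.
rewrite mxtrace_mulC !mulmxA tproj_idem -mulmxA PH mulmxBl !mulmxBr !linearB /=.
rewrite -/v; clearbody v.
have -> : \tr (H *m (N^T *m v)) = dot v v.
  by rewrite mulmxA -vT mxtrace_mulC trace11 dotE.
have -> : \tr (N^T *m v *m H) = dot v v.
  by rewrite -mulmxA mxtrace_mulC -mulmxA -vT trace11 dotE.
have -> : \tr (N^T *m v *m (N^T *m v)) = dot v N ^+ 2.
  rewrite -mulmxA mxtrace_mulC !mulmxA -(mulmxA (v *m N^T)).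
  by rewrite [v *m N^T]mx11_scalar -dotE mul_scalar_mx trace11 !mxE mulr1n expr2.
by rewrite mulr2n; ring.
Qed.

End projection.
End linear_algebra.

(** * Geometry of level sets *)

Section level_set_geometry.
Context {R : realType} (s : nat) (g : 'rV[R]_s -> R).
Hypothesis g2 : Ck 2 g.
Implicit Types (y v : 'rV[R]_s).

Definition hessian y : 'M[R]_s := \matrix_(k, l) partial k (partial l g) y.

Lemma Ck2_partial i : Ck 1 (partial i g).
Proof. exact: g2.2. Qed.

Lemma Ck2_Ck1 : Ck 1 g.
Proof. by split; [exact: g2.1|move=> i; exact: Ck1_continuous (Ck2_partial i)]. Qed.

Lemma partial_comm i j : partial i (partial j g) = partial j (partial i g).
Proof.
apply: derive_comm => [y|y|y|y||].
- exact: Ck1_derivable Ck2_Ck1.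
- exact: Ck1_derivable Ck2_Ck1.
- exact: Ck1_derivable (Ck2_partial _).
- exact: Ck1_derivable (Ck2_partial _).
- exact: Ck1_partial (Ck2_partial _).
- exact: Ck1_partial (Ck2_partial _).
Qed.

Lemma hessian_tr y : (hessian y)^T = hessian y.
Proof. by apply/matrixP => i j; rewrite !mxE partial_comm. Qed.

Lemma derive_sum_partial (F : 'rV[R]_s -> R) y v : differentiable F y ->
  'D_v F y = \sum_k v 0 k * partial k F y.
Proof.
move=> dF; rewrite deriveE// [X in 'd _ _ X](row_sum_delta v) linear_sum.
by apply: eq_bigr => k _; rewrite linearZ /= /partial deriveE.
Qed.

Lemma derive_grad y v l : 'D_v (partial l g) y = (v *m hessian y) 0 l.
Proof.
rewrite derive_sum_partial ?mxE; last exact: (Ck2_partial l).1.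
by apply: eq_bigr => k _; rewrite mxE.
Qed.

Let a y := \sum_l partial l g y * partial l g y.

Let enorm_gradE : (fun y => enorm (grad g y)) = fun y => Num.sqrt (a y).
Proof.
apply/funext => y; rewrite /enorm /dot; congr Num.sqrt.
by apply: eq_bigr => l _; rewrite !mxE.
Qed.

Let Ck1a : Ck 1 a.
Proof. by apply: Ck1_sum => l; apply: Ck1M; exact: Ck2_partial. Qed.

Let derive_a y v : 'D_v a y = 2 * dot (v *m hessian y) (grad g y).
Proof.
have aE : a = \sum_l (fun y => partial l g y * partial l g y).
  by apply/funext => z; rewrite fct_sumE.
have dl l : is_derive y v (fun y => partial l g y * partial l g y)
    (2 * ((v *m hessian y) 0 l * partial l g y)).
  have dgl : is_derive y v (partial l g) ((v *m hessian y) 0 l).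
    by apply: DeriveDef; [exact: Ck1_derivable (Ck2_partial l)|exact: derive_grad].
  by apply: is_derive_eq; rewrite /GRing.scale /=; ring.
rewrite aE (@derive_val _ _ _ _ _ _ _ (is_derive_sum dl)) -mulr_sumr.
by congr (_ * _); apply: eq_bigr => l _; rewrite [grad g y 0 l]mxE.
Qed.

Section regular_point.
Variable y : 'rV[R]_s.
Hypothesis gy : grad g y != 0.

Let w := grad g y.
Let p := enorm w.
Let N := unit_normal g y.

Let a_gt0 : 0 < a y.
Proof.
have -> : a y = dot w w by apply: eq_bigr => l _; rewrite !mxE.
by rewrite lt_neqAle eq_sym dot_eq0 gy dot_ge0.
Qed.

Let pE : p = Num.sqrt (a y).
Proof. by rewrite -[LHS]/((fun y => enorm (grad g y)) y) enorm_gradE. Qed.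

Let p_gt0 : 0 < p.
Proof. by rewrite pE sqrtr_gt0. Qed.

Let derivable_p v : derivable (fun z => enorm (grad g z)) y v.
Proof.
rewrite enorm_gradE; apply: diff_derivable.
exact: (diff_compR v (sqrt_derivable a_gt0) (Ck1a.1 y)).1.
Qed.

Lemma derive_enorm_grad v :
  'D_v (fun z => enorm (grad g z)) y = dot (v *m hessian y) N.
Proof.
rewrite enorm_gradE (diff_compR v (sqrt_derivable a_gt0) (Ck1a.1 y)).2.
rewrite derive_a derive1E derive_sqrt// -pE invfM.
rewrite mulrA -(mulrC p^-1) divfK ?pnatr_eq0//.
rewrite /N /unit_normal -/w -/p /dot mulr_sumr; apply: eq_bigr => k _.
by rewrite [(p^-1 *: w) 0 k]mxE mulrCA.
Qed.

Let N1 : dot N N = 1.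
Proof.
rewrite /N /unit_normal -/w -/p dotZl dotC dotZl -enorm_sqr -/p.
by rewrite mulrA -invfM -expr2 mulVf// sqrf_eq0 lt0r_neq0.
Qed.

Lemma derive_unit_normal v :
  'D_v (unit_normal g) y = p^-1 *: (v *m hessian y *m tproj N).
Proof.
have E k : (fun z => unit_normal g z 0 k) =
    (fun z => (enorm (grad g z))^-1) * partial k g.
  by apply/funext => z; rewrite !mxE.
have dpV : derivable (fun z => (enorm (grad g z))^-1) y v.
  by apply: (@derivableV R _ (fun z => enorm (grad g z))) => //; exact: lt0r_neq0.
have dgk k : derivable (partial k g) y v by exact: Ck1_derivable (Ck2_partial k).
rewrite derive_mx; last first.
  apply/derivable_mxP => i k; rewrite ord1 E; exact: derivableM dpV (dgk k).
apply/rowP => k; rewrite mxE E (deriveM dpV (dgk k)) derive_grad.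
have ndp := lt0r_neq0 p_gt0.
have dpVE := @deriveV R _ (fun z => enorm (grad g z)) y v ndp (@derivable_p v).
rewrite dpVE derive_enorm_grad mul_tproj.
move: (v *m hessian y) => z; move: (dot z N) => c.
rewrite 4!mxE [N 0 k]mxE -/w -/p [w 0 k]mxE /GRing.scale /=.
by move: (z 0 k) (partial k g y) => zk wk; field; exact: lt0r_neq0.
Qed.

(** On a principal direction e_i, orthogonal to N, multiplication by P H P is
    multiplication by - |grad g| kappa_i; Bessel's inequality then bounds the sum
    of the squared norms of these images. *)
Lemma principal_curvatures_le :
  p ^+ 2 * full_curvature g y ^+ 2 <= frob (tproj N *m hessian y *m tproj N).
Proof.
rewrite [X in _ * X <= _]sqr_sqrtr; last by apply: sumr_ge0 => i _; exact: sqr_ge0.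
have [[kappa0 kappa0P]|nokappa] :=
  pselect (exists kappa, is_principal_curvatures g y kappa); last first.
  (* Then [get] takes its default value 0, and so does the curvature. *)
  rewrite big1 ?mulr0 ?frob_ge0// => j _.
  rewrite /principal_curvatures getPN; last by move=> k kP; apply: nokappa; exists k.
  by rewrite mxE expr0n.
have [e [eT eON eS]] : is_principal_curvatures g y (principal_curvatures g y).
  exact: (getPex (ex_intro _ _ kappa0P)).
move: (principal_curvatures g y) eS => kappa eS.
pose E := \matrix_i e i.
have EE : E *m E^T = 1%:M.
  apply/matrixP => i j; rewrite mxE [RHS]mxE -eON.
  by apply: eq_bigr => k _; rewrite !mxE.
apply: le_trans (frob_bessel _ EE); rewrite frob_row mulr_sumr.
apply: ler_sum => i _.
have -> : row i (E *m (tproj N *m hessian y *m tproj N)) = (- (p * kappa 0 i)) *: e i.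
  have eP : e i *m tproj N = e i by rewrite mul_tproj (eT i) scale0r subr0.
  rewrite row_mul rowK !mulmxA eP.
  have -> : e i *m hessian y *m tproj N = p *: 'D_(e i) (unit_normal g) y.
    by rewrite derive_unit_normal scalerA divff ?scale1r// lt0r_neq0.
  rewrite -[X in p *: X]opprK -[- 'D_(e i) _ _]/(shape_operator g y (e i)).
  by rewrite eS scalerN scalerA scaleNr.
by rewrite dotZl dotC dotZl eON eqxx mulr1 mulrNN -expr2 exprMn.
Qed.

(** One half of the Sternberg-Zumbrun identity.  With v = N *m H = grad |grad g|,
    the tangential part of v has squared norm |v|^2 - (v . N)^2, so the claim is
    |grad g|^2 K^2 <= |H|^2 - 2 |v|^2 + (v . N)^2 = |P H P|^2. *)
Lemma curvature_tangential_le :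
  enorm (grad g y) ^+ 2 * full_curvature g y ^+ 2 +
  enorm (tangent_proj g y (grad (fun z => enorm (grad g z)) y)) ^+ 2 <=
  \sum_k \sum_j partial k (partial j g) y ^+ 2
  - enorm (grad (fun z => enorm (grad g z)) y) ^+ 2.
Proof.
(* The derivative in direction v is (v H) . N, so the gradient is H N; this is
   N H by the symmetry of H. *)
have gp : grad (fun z => enorm (grad g z)) y = N *m hessian y.
  apply/rowP => k; rewrite mxE /partial derive_enorm_grad -rowE.
  rewrite -[in RHS]hessian_tr [RHS]mxE; apply: eq_bigr => l _.
  by rewrite [row _ _ _ _]mxE [(hessian y)^T _ _]mxE mulrC.
have -> : \sum_k \sum_j partial k (partial j g) y ^+ 2 = frob (hessian y).
  by rewrite frobE; apply: eq_bigr => k _; apply: eq_bigr => j _; rewrite mxE.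
rewrite gp; have -> : tangent_proj g y (N *m hessian y) = N *m hessian y *m tproj N.
  by rewrite mul_tproj.
rewrite !(enorm_sqr (_ *m _)) (dot_mul_tproj N1).
have := principal_curvatures_le; rewrite (frob_tproj N1 (hessian_tr y)).
rewrite -/w -/p mulr2n.
move: (p ^+ 2 * _) (frob _) (dot _ (N *m _)) (dot _ N ^+ 2) => k1 k2 k3 k4.
by move=> ?; lra.
Qed.

End regular_point.
End level_set_geometry.

(** * Slices of a function on R^(d+s) *)

Section slice.
Context {R : realType} (d s : nat).
Implicit Types (h : 'rV[R]_(d + s) -> R).

Lemma partial_slice (x' : 'rV[R]_d) h k :
  partial k (slice h x') = slice (partial (rshift d k) h) x'.
Proof.
apply/funext => z; apply: (derive_along (L := fun z : 'rV[R]_s => row_mx x' z)) => t.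
apply/rowP => i; case: (split_ordP i) => j ->;
    rewrite [RHS]mxE ?row_mxEl ?row_mxEr !mxE.
  by rewrite eq_lrshift andbF mulr0 add0r.
by rewrite (inj_eq (@rshift_inj _ _)).
Qed.

Lemma differentiable_row_mx (x' : 'rV[R]_d) (z : 'rV[R]_s) :
  differentiable (fun z => row_mx x' z) z.
Proof.
pose B : 'M[R]_(s, d + s) := row_mx 0 1%:M.
have -> : (fun z => row_mx x' z) = (fun z => row_mx x' 0 + mulmxr B z).
  by apply/funext => t; rewrite /= mul_mx_row mulmx0 mulmx1 add_row_mx addr0 add0r.
apply: differentiableD; first exact: differentiable_cst.
apply: linear_differentiable; apply: continuous_rV => i.
rewrite (_ : (fun t => _) = (fun t : 'rV[R]_s => \sum_j t 0 j * B j i)).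
  apply: continuous_sumf => j; apply: continuousMf; first exact: coord_continuous.
  exact: cst_continuous.
by apply/funext => t; rewrite /= mxE.
Qed.

Lemma Ck_slice k (x' : 'rV[R]_d) h : Ck k h -> Ck k (slice h x').
Proof.
elim: k h => [|k IH] h /=.
  move=> ch z; apply: (@continuous_comp _ _ _ (fun z => row_mx x' z) h); last exact: ch.
  exact: differentiable_continuous (differentiable_row_mx _ _).
move=> [dh ch]; split => [z|i]; last by rewrite partial_slice; exact: IH.
apply: (@differentiable_comp _ _ _ _ (fun z => row_mx x' z) h); last exact: dh.
exact: differentiable_row_mx.
Qed.

Lemma grad_slice (x' : 'rV[R]_d) h (z : 'rV[R]_s) :
  grad (slice h x') z = grad_r h (row_mx x' z).
Proof. by apply/rowP => k; rewrite !mxE partial_slice. Qed.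

End slice.

(** At a zero of a nonnegative function the difference quotients have the sign of
    the increment, so a derivative must be 0; where there is none, ['D_v] is 0 as
    the default value of a limit. *)
Lemma derive_nonneg_zero (R : realType) (V : normedModType R) (h : V -> R) x v :
  (forall y, 0 <= h y) -> h x = 0 -> 'D_v h x = 0.
Proof.
move=> h0 hx; have [dh|ndh] := pselect (derivable h x v); last exact: dvgP ndh.
have dl : (fun t : R => t^-1 *: (h (t *: v + x) - h x)) @ 0^' --> 'D_v h x by exact: dh.
have nz n : (n.+1%:R^-1 : R) != 0 by rewrite invr_neq0.
have cv : (fun n => n.+1%:R^-1 : R) @ \oo --> (0 : R) by exact: cvg_harmonic.
apply/eqP; rewrite eq_le; apply/andP; split.
- have ncv : (fun n => - n.+1%:R^-1 : R) @ \oo --> (0 : R).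
    by rewrite -oppr0; exact: cvgN.
  have nnz n : (- n.+1%:R^-1 : R) != 0 by rewrite oppr_eq0.
  have lim1 := (cvgr_dnbhsP _ _ _).1 dl _ (conj nnz ncv).
  apply: (cvgr_to_le lim1); apply: nearW => n.
  by rewrite hx subr0 invrN scaleNr oppr_le0; apply: mulr_ge0.
- have lim1 := (cvgr_dnbhsP _ _ _).1 dl _ (conj nz cv).
  apply: (cvgr_to_ge lim1); apply: nearW => n.
  by rewrite hx subr0; apply: mulr_ge0.
Qed.

Lemma measurable_inv (R : realType) :
  measurable_fun setT (GRing.inv : measurableTypeR R -> measurableTypeR R).
Proof.
have -> : [set: measurableTypeR R] = [set 0] `|` ~` [set 0] by rewrite setUv.
apply/measurable_funU => //; first exact: measurableC.
split; first exact: measurable_fun_set1.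
apply: open_continuous_measurable_fun.
  by apply: closed_openC; exact: closed_eq.
by move=> x; rewrite inE /= => /eqP; exact: inv_continuous.
Qed.

(** * The stability inequality *)

Section stability.
Context {R : realType} (d s : nat) (u : 'rV[R]_(d + s) -> R).
Hypothesis u2 : Ck 2 u.
Implicit Types (x : 'rV[R]_(d + s)) (i : 'I_(d + s)) (j : 'I_s).

(** The quantities w_j, |w|^2, w . d_i w and |d_i w|^2 of the stability argument,
    for w = [grad_r u]. *)
Definition ur j := partial (rshift d j) u.

Definition ur_sqr x := \sum_j ur j x * ur j x.
Definition ur_Dur i x := \sum_j ur j x * partial i (ur j) x.
Definition Dur_sqr i x := \sum_j partial i (ur j) x ^+ 2.

Let Ck1_ur j : Ck 1 (ur j). Proof. exact: u2.2. Qed.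

Let Ck1_ur_sqr : Ck 1 ur_sqr.
Proof. by apply: Ck1_sum => j; exact: Ck1M. Qed.

Let continuous_ur_Dur i : continuous (ur_Dur i).
Proof.
apply: continuous_sumf => j; apply: continuousMf.
  exact: Ck1_continuous (Ck1_ur j).
exact: Ck1_partial (Ck1_ur j).
Qed.

Let continuous_Dur_sqr i : continuous (Dur_sqr i).
Proof.
by apply: continuous_sumf => j; apply: continuousXf; exact: Ck1_partial (Ck1_ur j).
Qed.

Let ur_sqr_ge0 x : 0 <= ur_sqr x.
Proof. by apply: sumr_ge0 => j _; rewrite -expr2 sqr_ge0. Qed.

Let ur_sqr_eq0 x j : ur_sqr x = 0 -> ur j x = 0.
Proof.
move=> A0; apply/eqP; rewrite -sqrf_eq0 expr2.
by move/eqP: A0; rewrite psumr_eq0; [move/allP => /(_ j); rewrite mem_index_enum; exact|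
  move=> k _; rewrite -expr2 sqr_ge0].
Qed.

Let partial_ur_sqr i x : partial i ur_sqr x = 2 * ur_Dur i x.
Proof.
rewrite /ur_sqr partial_sum; last by move=> j; exact: Ck1M.
rewrite /ur_Dur mulr_sumr; apply: eq_bigr => j _.
by rewrite partialM//; ring.
Qed.

Let norm_grad_rE : norm_grad_r u = fun x => Num.sqrt (ur_sqr x).
Proof.
apply/funext => x; rewrite /norm_grad_r /enorm /dot; congr Num.sqrt.
by apply: eq_bigr => j _; rewrite !mxE.
Qed.

Let norm_grad_r_sqr x : norm_grad_r u x ^+ 2 = ur_sqr x.
Proof. by rewrite norm_grad_rE sqr_sqrtr. Qed.

(** At a zero of [grad_r u] both sides are 0: the right-hand side by the convention
    on division, the left-hand side by [derive_nonneg_zero].  So the formula holds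
    at every point, and no null set has to be discarded. *)
Lemma partial_norm_grad_r i x :
  partial i (norm_grad_r u) x = ur_Dur i x / Num.sqrt (ur_sqr x).
Proof.
rewrite norm_grad_rE; have [A0|A0] := eqVneq (ur_sqr x) 0.
  rewrite A0 sqrtr0 invr0 mulr0; apply: derive_nonneg_zero => [y|].
    exact: sqrtr_ge0.
  by rewrite A0 sqrtr0.
have Agt0 : 0 < ur_sqr x by rewrite lt_neqAle eq_sym A0 ur_sqr_ge0.
rewrite partial_sqrt ?partial_ur_sqr//; last exact: Ck1_ur_sqr.1.
by rewrite invfM mulrA -(mulrC (Num.sqrt _)^-1) divfK ?pnatr_eq0// mulrC.
Qed.

Let ur_Dur_le i x : ur_Dur i x ^+ 2 / ur_sqr x <= Dur_sqr i x.
Proof. exact: cauchy_schwarz. Qed.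

Let ur_Dur_eps i x e : 0 < e ->
  ur_Dur i x ^+ 2 / (ur_sqr x + e) <= ur_Dur i x ^+ 2 / ur_sqr x.
Proof.
move=> e0; have [A0|A0] := eqVneq (ur_sqr x) 0.
  rewrite /ur_Dur big1 ?expr0n ?mul0r//= => j _; by rewrite ur_sqr_eq0 ?mul0r.
have Agt0 : 0 < ur_sqr x by rewrite lt_neqAle eq_sym A0 ur_sqr_ge0.
by rewrite ler_wpM2l ?sqr_ge0// lef_pV2 ?posrE ?addr_gt0// lerDl ltW.
Qed.

(** The sum over i of |d_i w|^2 - (d_i |w|)^2, for the derivatives in x' and for
    those in x''.  The first is [calS u], the second dominates the curvature term. *)
Definition defect_l x :=
  \sum_(k < d) (Dur_sqr (lshift s k) x - ur_Dur (lshift s k) x ^+ 2 / ur_sqr x).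

Definition defect_r x :=
  \sum_(k < s) (Dur_sqr (rshift d k) x - ur_Dur (rshift d k) x ^+ 2 / ur_sqr x).

Let defect_l_ge0 x : 0 <= defect_l x.
Proof. by apply: sumr_ge0 => k _; rewrite subr_ge0. Qed.

Let defect_r_ge0 x : 0 <= defect_r x.
Proof. by apply: sumr_ge0 => k _; rewrite subr_ge0. Qed.

Lemma calS_defect_l x : calS u x = defect_l x.
Proof.
rewrite /calS /defect_l sumrB exchange_big /=; congr (_ - _).
  by apply: eq_bigr => k _; apply: eq_bigr => j _; rewrite real_normK// num_real.
rewrite enorm_sqr; apply: eq_bigr => k _; rewrite !mxE partial_norm_grad_r.
by rewrite -expr2 expr_div_n sqr_sqrtr.
Qed.

Lemma curvature_le_defect_r x : grad_r u x != 0 ->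
  norm_grad_r u x ^+ 2 * curvature u x ^+ 2 +
  enorm (grad_T u (norm_grad_r u) x) ^+ 2 <= defect_r x.
Proof.
move=> ux.
pose g := slice u (lsubmx x); pose y := rsubmx x.
have xE : row_mx (lsubmx x) y = x by rewrite hsubmxK.
have gy z : grad g z = grad_r u (row_mx (lsubmx x) z) by exact: grad_slice.
have ng : (fun z => enorm (grad g z)) = slice (norm_grad_r u) (lsubmx x).
  by apply/funext => z; rewrite gy.
have gn : grad (fun z => enorm (grad g z)) y = grad_r (norm_grad_r u) x.
  by rewrite ng grad_slice xE.
have := @curvature_tangential_le R s g (Ck_slice _ u2) y.
rewrite gn gy xE => /(_ ux).
have -> : \sum_k \sum_j partial k (partial j g) y ^+ 2 =
    \sum_(k < s) Dur_sqr (rshift d k) x.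
  have E k j : partial k (partial j g) y = partial (rshift d k) (ur j) x.
    by rewrite !partial_slice /slice xE.
  apply: eq_bigr => k _.
  by apply: eq_bigr => j _; rewrite E.
have -> : enorm (grad_r (norm_grad_r u) x) ^+ 2 =
    \sum_(k < s) ur_Dur (rshift d k) x ^+ 2 / ur_sqr x.
  rewrite enorm_sqr; apply: eq_bigr => k _; rewrite !mxE partial_norm_grad_r.
  by rewrite -expr2 expr_div_n sqr_sqrtr.
by rewrite -sumrB.
Qed.

Let measurable_ur_sqr_inv : measurable_fun setT
  ((fun x => (ur_sqr x)^-1) : borel_rV R (d + s) -> measurableTypeR R).
Proof.
apply: measurableT_comp (@measurable_inv R) _.
by apply: continuous_measurable_borel_rV; exact: Ck1_continuous Ck1_ur_sqr.
Qed.

Let continuous_m (g : 'rV[R]_(d + s) -> R) : continuous g ->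
  measurable_fun setT (g : borel_rV R (d + s) -> measurableTypeR R).
Proof. exact: continuous_measurable_borel_rV. Qed.

Let measurable_defect i : measurable_fun setT
  ((fun x => Dur_sqr i x - ur_Dur i x ^+ 2 / ur_sqr x) :
    borel_rV R (d + s) -> measurableTypeR R).
Proof.
apply: measurable_funB; first exact: continuous_m.
by apply: measurable_funM => //; apply: continuous_m; exact: continuousXf.
Qed.

Let measurable_defect_l : measurable_fun setT
  (defect_l : borel_rV R (d + s) -> measurableTypeR R).
Proof. by apply: measurable_sum => k; exact: measurable_defect. Qed.

Let measurable_defect_r : measurable_fun setT
  (defect_r : borel_rV R (d + s) -> measurableTypeR R).
Proof. by apply: measurable_sum => k; exact: measurable_defect. Qed.

Section estimate.
Variables (gamma lambda : 'rV[R]_d -> R) (f : R -> R) (M : R).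
Hypotheses (gamma1 : Ck 1 gamma).
Hypothesis gamma_ge0 : forall x' : 'rV[R]_d, 0 <= gamma x'.
Hypotheses (lambda1 : Ck 1 lambda) (f1 : C1_real f).
Hypothesis u_sol : forall x,
  - div_weighted_grad gamma u x = lambda (lsubmx x) * f (u x).

Let gam x := gamma (lsubmx x).
Let lamf x := lambda (lsubmx x) * derive1 f (u x).

Let Ck1_gam : Ck 1 gam. Proof. exact: Ck1_lsubmx. Qed.

Let Ck1u : Ck 1 u. Proof. exact: Ck2_Ck1 u2. Qed.

Let continuous_lamf : continuous lamf.
Proof.
apply: continuousMf; first exact: Ck1_continuous (Ck1_lsubmx s lambda1).
move=> x; apply: (@continuous_comp _ _ _ u (derive1 f)).
  exact: (Ck1_continuous Ck1u).
exact: f1.2.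
Qed.

(** The weights do not depend on x_(d+j), so differentiating the coefficients
    gamma d_i u and lambda f(u) in this direction gives gamma d_i w_j and
    lambda f'(u) w_j. *)
Lemma linearized_equation j psi : Ck 1 psi -> zero_off_box M psi ->
  int_rV (fun x => \sum_i gam x * partial i (ur j) x * partial i psi x) =
  int_rV (fun x => lamf x * ur j x * psi x).
Proof.
move=> cpsi psi0.
have ca i : Ck 1 (fun x => gam x * partial i u x).
  by apply: Ck1M; [exact: Ck1_gam|exact: u2.2].
have cL : Ck 1 (fun x : 'rV[R]_(d + s) => lambda (lsubmx x)) by exact: Ck1_lsubmx.
have cfu : Ck 1 (fun x => f (u x)) by exact: Ck1_comp.
have cF : Ck 1 (fun x => lambda (lsubmx x) * f (u x)) by exact: Ck1M.
pose e : 'rV[R]_(d + s) := delta_mx 0 (rshift d j).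
have Da i : 'D_e (fun x => gam x * partial i u x) =
    fun x => gam x * partial i (ur j) x.
  apply: (etrans (partialM (rshift d j) Ck1_gam (u2.2 i))); apply/funext => x.
  by rewrite /gam partial_lsubmxr mul0r add0r (partial_comm u2).
have DF : 'D_e (fun x => lambda (lsubmx x) * f (u x)) = fun x => lamf x * ur j x.
  apply: (etrans (partialM (rshift d j) cL cfu)); apply/funext => x.
  by rewrite partial_lsubmxr mul0r add0r (partial_comp _ f1.1 Ck1u) mulrA.
have cDa i : continuous ('D_e (fun x => gam x * partial i u x)).
  rewrite Da; apply: continuousMf; first exact: Ck1_continuous Ck1_gam.
  exact: Ck1_partial (Ck1_ur j).
have cDF : continuous ('D_e (fun x => lambda (lsubmx x) * f (u x))).
  by rewrite DF; apply: continuousMf => //; exact: Ck1_continuous (Ck1_ur j).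
have W := weak_div_derive ca cF cDa cDF u_sol cpsi psi0.
apply: etrans (etrans W _); congr int_rV; apply/funext => x.
  by apply: eq_bigr => i _; congr (_ * _); rewrite (congr1 (fun F => F x) (Da i)).
by congr (_ * _); exact: (congr1 (fun F => F x) DF).
Qed.

Variable phi : 'rV[R]_(d + s) -> R.
Hypotheses (phi1 : Ck 1 phi) (phi0 : zero_off_box M phi).
Hypothesis phiC : compact (closure [set x | phi x != 0]).
Hypothesis u_stable : stable gamma lambda f u.

Let gphi2 x := \sum_i partial i phi x ^+ 2.

Let cont_box_phi2 : cont_box M (fun x => phi x ^+ 2).
Proof.
split; first by apply: continuousXf; exact: Ck1_continuous phi1.
by move=> x xM; rewrite phi0// expr0n.
Qed.

Let cont_box_gphi2 : cont_box M gphi2.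
Proof.
apply: cont_box_sum => i; have [ci i0] := cont_box_partial i phi1 phi0.
split; first exact: continuousXf.
by move=> x xM; rewrite i0// expr0n.
Qed.

Let continuous_gam : continuous gam.
Proof. exact: Ck1_continuous Ck1_gam. Qed.

Let continuous_ur_sqr : continuous ur_sqr.
Proof. exact: Ck1_continuous Ck1_ur_sqr. Qed.

Let continuous_ur j : continuous (ur j).
Proof. exact: Ck1_continuous (Ck1_ur j). Qed.

Let continuous_partial_ur j i : continuous (partial i (ur j)).
Proof. exact: Ck1_partial (Ck1_ur j). Qed.

Let partial_ur_phi2 j i x : partial i (fun x => ur j x * (phi x * phi x)) x =
  partial i (ur j) x * phi x ^+ 2 + ur j x * (2 * (phi x * partial i phi x)).
Proof.
have pp : Ck 1 (fun x => phi x * phi x) by exact: Ck1M.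
by rewrite (partialM i (Ck1_ur j) pp) (partialM i phi1 phi1); ring.
Qed.

(** sum_j gamma grad w_j . grad (w_j phi^2) *)
Let lin x := \sum_j \sum_i gam x * partial i (ur j) x *
  (partial i (ur j) x * phi x ^+ 2 + ur j x * (2 * (phi x * partial i phi x))).

Let cont_box_lin j : cont_box M (fun x => \sum_i gam x * partial i (ur j) x *
  (partial i (ur j) x * phi x ^+ 2 + ur j x * (2 * (phi x * partial i phi x)))).
Proof.
apply: cont_box_sum => i; apply: cont_boxMl.
  exact: continuousMf continuous_gam (@continuous_partial_ur j i).
apply: cont_boxD; first exact: cont_boxMl.
apply: cont_boxMl => //; apply: cont_boxMl; first exact: cst_continuous.
by apply: cont_boxMl (cont_box_partial i phi1 phi0); exact: Ck1_continuous phi1.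
Qed.

Let int_lin : int_rV lin = int_rV (fun x => lamf x * ur_sqr x * phi x ^+ 2).
Proof.
rewrite /lin (int_rV_sum _ cont_box_lin).
transitivity (\sum_j int_rV (fun x => lamf x * ur j x * (ur j x * (phi x * phi x)))).
  apply: eq_bigr => j _; rewrite -linearized_equation.
  - congr int_rV; apply/funext => x; apply: eq_bigr => i _.
    by rewrite partial_ur_phi2.
  - by apply: Ck1M; [exact: Ck1_ur|exact: Ck1M].
  - by move=> x xM; rewrite phi0// !mulr0.
rewrite -(int_rV_sum (M := M)).
  congr int_rV; apply/funext => x; rewrite /ur_sqr mulr_sumr mulr_suml.
  by apply: eq_bigr => j _; ring.
move=> j; apply: cont_boxMl.
  exact: continuousMf continuous_lamf (@continuous_ur j).
by apply: cont_boxMl => //; have := cont_box_phi2; under eq_fun do rewrite expr2.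
Qed.

Let dens_r x := gam x * phi x ^+ 2 * defect_r x.
Let dens_l x := gam x * phi x ^+ 2 * defect_l x.

Let gam_phi2_ge0 x : 0 <= gam x * phi x ^+ 2.
Proof. by rewrite mulr_ge0 ?sqr_ge0//; exact: gamma_ge0. Qed.

Let dens_r_ge0 x : 0 <= dens_r x. Proof. exact: mulr_ge0. Qed.

Let dens_l_ge0 x : 0 <= dens_l x. Proof. exact: mulr_ge0. Qed.

Let measurable_dens (g : 'rV[R]_(d + s) -> R) :
  measurable_fun setT (g : borel_rV R (d + s) -> measurableTypeR R) ->
  measurable_fun setT (EFin \o (fun x => gam x * phi x ^+ 2 * g x) :
    borel_rV R (d + s) -> \bar R).
Proof.
move=> mg; apply/measurable_EFinP; apply: measurable_funM => //.
by apply: continuous_m; exact: (cont_boxMl continuous_gam cont_box_phi2).1.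
Qed.

Section eps.
Variable e : R.
Hypothesis e0 : 0 < e.

Let v x := Num.sqrt (ur_sqr x + e).
Let psi x := phi x * v x.

Let ur_sqr_eps_gt0 x : 0 < ur_sqr x + e. Proof. exact: ltr_wpDl. Qed.

Let v_neq0 x : v x != 0. Proof. by rewrite lt0r_neq0// sqrtr_gt0. Qed.

Let v_sqr x : v x ^+ 2 = ur_sqr x + e. Proof. by rewrite sqr_sqrtr// ltW. Qed.

Let Ck1_ur_sqr_eps : Ck 1 (fun x => ur_sqr x + e).
Proof. exact: Ck1D Ck1_ur_sqr (Ck1_cst _ e). Qed.

Let Ck1v : Ck 1 v. Proof. exact: Ck1_sqrt. Qed.

Let partial_v i x : partial i v x = ur_Dur i x / v x.
Proof.
rewrite (partial_sqrt _ (Ck1_ur_sqr_eps.1 x) (ur_sqr_eps_gt0 x)).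
rewrite (partialD i Ck1_ur_sqr (Ck1_cst _ e)).
rewrite partial_cst addr0 partial_ur_sqr -/(v x) invfM.
by rewrite mulrA -(mulrC (v x)^-1) divfK ?pnatr_eq0// mulrC.
Qed.

Let Ck1psi : Ck 1 psi. Proof. exact: Ck1M. Qed.

Let partial_psi i x :
  partial i psi x = partial i phi x * v x + phi x * (ur_Dur i x / v x).
Proof. by rewrite (partialM i phi1 Ck1v) partial_v. Qed.

Let psi0 : zero_off_box M psi.
Proof. by move=> x xM; rewrite /psi phi0// mul0r. Qed.

Let psi_C1c : C1c psi.
Proof.
split=> //; apply: (subclosed_compact _ phiC); first exact: closed_closure.
apply: closureS => x /=; apply: contra_neq => p0.
by rewrite /psi p0 mul0r.
Qed.

Let cont_box_gpsi2 : cont_box M (fun x => dot (grad psi x) (grad psi x)).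
Proof.
apply: cont_box_sum => i; have pc := cont_box_partial i Ck1psi psi0.
rewrite (_ : (fun x => _) = fun x => partial i psi x * partial i psi x).
  exact: cont_boxMl pc.1 pc.
by apply/funext => x; rewrite !mxE.
Qed.

Let cont_box_psi2 : cont_box M (fun x => psi x ^+ 2).
Proof.
split; first by apply: continuousXf; exact: Ck1_continuous Ck1psi.
by move=> x xM; rewrite psi0// expr0n.
Qed.

Let stab_psi : int_rV (fun x => lamf x * psi x ^+ 2) <=
  int_rV (fun x => gam x * dot (grad psi x) (grad psi x)).
Proof.
have := u_stable psi_C1c; rewrite -lee_fin.
rewrite -(EFin_int_rV (M := M)); last exact: cont_boxMl.
rewrite -(EFin_int_rV (M := M)); last exact: cont_boxMl.
by under [X in (_ <= X)%E -> _]eq_integral do rewrite enorm_sqr.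
Qed.

(** gamma phi^2 (sum_j |grad w_j|^2 - |grad v|^2) *)
Let excess x := gam x * phi x ^+ 2 *
  \sum_i (Dur_sqr i x - ur_Dur i x ^+ 2 / (ur_sqr x + e)).

Let cont_box_excess : cont_box M excess.
Proof.
rewrite (_ : excess = fun x => (gam x *
    \sum_i (Dur_sqr i x - ur_Dur i x ^+ 2 / (ur_sqr x + e))) * phi x ^+ 2).
  apply: cont_boxMl => //; apply: continuousMf => //; apply: continuous_sumf => i.
  apply: continuousDf => //; apply: continuousNf; apply: continuousMf.
    exact: continuousXf.
  apply: continuousVf; first by move=> x; exact: lt0r_neq0.
  exact: Ck1_continuous Ck1_ur_sqr_eps.
by apply/funext => x; rewrite mulrAC.
Qed.

(** The cancellation of the cross terms 2 gamma phi grad phi . (w . grad w) of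
    [lin] and of gamma |grad psi|^2. *)
Let excessE x : excess x = lin x - gam x * dot (grad psi x) (grad psi x) +
  gam x * (ur_sqr x + e) * gphi2 x.
Proof.
have -> : lin x = \sum_i (gam x * phi x ^+ 2 * Dur_sqr i x +
    2 * gam x * phi x * partial i phi x * ur_Dur i x).
  rewrite /lin exchange_big; apply: eq_bigr => i _.
  rewrite /Dur_sqr /ur_Dur !mulr_sumr -big_split /=; apply: eq_bigr => j _; ring.
rewrite /dot /gphi2 /excess !mulr_sumr -sumrB -big_split; apply: eq_bigr => i _ /=.
rewrite !mxE partial_psi -v_sqr; have := v_neq0 x.
move: (v x) (ur_Dur i x) (Dur_sqr i x) (partial i phi x) (phi x) (gam x).
move=> vx Tx Dx px fx gx vx0.
by field.
Qed.

(** Integrating [excessE], the linearized equation evaluates the integral of [lin]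
    and stability bounds that of gamma |grad psi|^2 from below; the terms in
    lambda f'(u) |w|^2 phi^2 cancel. *)
Lemma stability_eps : int_rV excess <= int_rV (fun x => gam x * ur_sqr x * gphi2 x) +
  e * (int_rV (fun x => gam x * gphi2 x) - int_rV (fun x => lamf x * phi x ^+ 2)).
Proof.
have L_cc : cont_box M lin by exact: cont_box_sum cont_box_lin.
have Y_cc : cont_box M (fun x => gam x * dot (grad psi x) (grad psi x)).
  exact: cont_boxMl.
have G_cc : cont_box M (fun x => gam x * gphi2 x) by exact: cont_boxMl.
have GA_cc : cont_box M (fun x => gam x * ur_sqr x * gphi2 x).
  by apply: cont_boxMl => //; exact: continuousMf.
have p_cc : cont_box M (fun x => lamf x * phi x ^+ 2) by exact: cont_boxMl.
have Ap_cc : cont_box M (fun x => lamf x * ur_sqr x * phi x ^+ 2).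
  by apply: cont_boxMl => //; exact: continuousMf.
have eG_cc : cont_box M (fun x => e * (gam x * gphi2 x)).
  by apply: cont_boxMl => //; exact: cst_continuous.
have ep_cc : cont_box M (fun x => e * (lamf x * phi x ^+ 2)).
  by apply: cont_boxMl => //; exact: cst_continuous.
have -> : excess = fun x => (lin x - gam x * dot (grad psi x) (grad psi x)) +
    (gam x * ur_sqr x * gphi2 x + e * (gam x * gphi2 x)).
  by apply/funext => x; rewrite excessE; ring.
rewrite (int_rVD (cont_boxD L_cc (cont_boxN Y_cc)) (cont_boxD GA_cc eG_cc)).
rewrite (int_rVB L_cc Y_cc) (int_rVD GA_cc eG_cc) (int_rVZ _ G_cc) int_lin.
have := stab_psi.
have -> : (fun x => lamf x * psi x ^+ 2) = fun x =>
    lamf x * ur_sqr x * phi x ^+ 2 + e * (lamf x * phi x ^+ 2).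
  by apply/funext => x; rewrite /psi exprMn v_sqr; ring.
rewrite (int_rVD Ap_cc ep_cc) (int_rVZ _ p_cc).
move: (int_rV _) (int_rV _) (int_rV _) (int_rV _) (int_rV _) => k1 k2 k3 k4 k5.
by lra.
Qed.

Let dens_le_excess x : dens_r x + dens_l x <= excess x.
Proof.
rewrite /dens_r /dens_l -mulrDr; apply: ler_wpM2l.
  by rewrite mulr_ge0 ?sqr_ge0//; exact: gamma_ge0.
rewrite addrC [leRHS]big_split_ord /=; apply: lerD; apply: ler_sum => k _;
  by rewrite lerB// ur_Dur_eps.
Qed.

Lemma integral_dens_le_eps :
  (\int[lebesgue_rV R (d + s)]_x (dens_r x + dens_l x)%:E <=
   (int_rV (fun x => gam x * ur_sqr x * gphi2 x) +
    e * (int_rV (fun x => gam x * gphi2 x) -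
         int_rV (fun x => lamf x * phi x ^+ 2)))%:E)%E.
Proof.
apply: (@le_trans _ _ (int_rV excess)%:E); last first.
  by rewrite lee_fin; exact: stability_eps.
rewrite -(EFin_int_rV cont_box_excess); apply: ge0_le_integral_nonmeas => x _.
  by rewrite lee_fin addr_ge0.
by rewrite lee_fin dens_le_excess.
Qed.

End eps.

Lemma integral_dens_le : (\int[lebesgue_rV R (d + s)]_x (dens_r x + dens_l x)%:E <=
  (int_rV (fun x => gam x * ur_sqr x * gphi2 x))%:E)%E.
Proof.
set r := int_rV (fun x => gam x * ur_sqr x * gphi2 x).
set c := int_rV (fun x => gam x * gphi2 x) - int_rV (fun x => lamf x * phi x ^+ 2).
apply/lee_addgt0Pr => k k0.
have c1 : 0 < `|c| + 1 by rewrite ltr_wpDl.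
have e0 : 0 < k / (`|c| + 1) by rewrite divr_gt0.
apply: le_trans (integral_dens_le_eps e0) _; rewrite -EFinD lee_fin lerD2l -/c.
rewrite mulrAC ler_pdivrMr// ler_wpM2l ?(ltW k0)//.
by rewrite (le_trans (ler_norm c))// lerDl.
Qed.

(** The curvature term is bounded by [dens_r], which is measurable, before Tonelli's
    theorem turns the iterated integral into one over R^(d+s). *)
Lemma stability_poincare :
  (\int[lebesgue_rV R d]_x'
     ((gamma x')%:E *
      \int[lebesgue_rV R s]_(x'' in
          [set x'' : 'rV[R]_s | grad_r u (row_mx x' x'') != 0%R])
        let x := row_mx x' x'' in
        (phi x ^+ 2 *
           (norm_grad_r u x ^+ 2 * curvature u x ^+ 2
            + enorm (grad_T u (norm_grad_r u) x) ^+ 2))%:E)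
   + \int[lebesgue_rV R (d + s)]_x
       (gamma (lsubmx x) * phi x ^+ 2 * calS u x)%:E
   <= \int[lebesgue_rV R (d + s)]_x
       (gamma (lsubmx x) * norm_grad_r u x ^+ 2 * enorm (grad phi x) ^+ 2)%:E)%E.
Proof.
have -> : (\int[lebesgue_rV R (d + s)]_x
    (gamma (lsubmx x) * norm_grad_r u x ^+ 2 * enorm (grad phi x) ^+ 2)%:E =
    (int_rV (fun x => gam x * ur_sqr x * gphi2 x))%:E)%E.
  rewrite -(EFin_int_rV (M := M)); last by apply: cont_boxMl => //; exact: continuousMf.
  apply: eq_integral => x _; rewrite norm_grad_r_sqr enorm_sqr.
  by congr (_ * _)%:E; apply: eq_bigr => i _; rewrite !mxE.
apply: le_trans integral_dens_le.
have -> : (\int[lebesgue_rV R (d + s)]_x (dens_r x + dens_l x)%:E =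
    \int[lebesgue_rV R (d + s)]_x (dens_r x)%:E +
    \int[lebesgue_rV R (d + s)]_x (dens_l x)%:E)%E.
  rewrite -ge0_integralD//; first by move=> x _; rewrite lee_fin.
  - exact: measurable_dens measurable_defect_r.
  - by move=> x _; rewrite lee_fin.
  - exact: measurable_dens measurable_defect_l.
apply: leeD; last first.
  rewrite le_eqVlt; apply/orP; left.
  by apply/eqP/eq_integral => x _; rewrite calS_defect_l.
rewrite ge0_integral_row_mx; last 2 first.
- exact: measurable_dens measurable_defect_r.
- by move=> x; rewrite lee_fin.
have curv_ge0 x : 0 <= phi x ^+ 2 * (norm_grad_r u x ^+ 2 * curvature u x ^+ 2
            + enorm (grad_T u (norm_grad_r u) x) ^+ 2).
  apply: mulr_ge0 (sqr_ge0 _) _; apply: addr_ge0 (sqr_ge0 _).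
  exact: mulr_ge0 (sqr_ge0 _) (sqr_ge0 _).
apply: ge0_le_integral_nonmeas => x' _.
  rewrite mule_ge0 ?lee_fin//; apply: integral_ge0 => x'' _.
  by rewrite lee_fin; exact: curv_ge0.
have mphiQ : measurable_fun setT ((fun x'' : borel_rV R s =>
    (phi (row_mx x' x'') ^+ 2 * defect_r (row_mx x' x''))%:E)).
  apply: (measurableT_comp
    (f := fun x : borel_rV R (d + s) => (phi x ^+ 2 * defect_r x)%:E)).
    apply/measurable_EFinP; apply: measurable_funM => //.
    exact: continuous_m cont_box_phi2.1.
  have mp := pair1_measurable (T2 := borel_rV R s) (x' : borel_rV R d).
  exact: (measurableT_comp (@measurable_row_mx R d s) mp).
rewrite [leRHS](_ : _ = ((gamma x')%:E * \int[lebesgue_rV R s]_x''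
    (phi (row_mx x' x'') ^+ 2 * defect_r (row_mx x' x''))%:E)%E); last first.
  rewrite -ge0_integralZl//.
  - by apply: eq_integral => x'' _; rewrite /dens_r /gam row_mxKl -mulrA EFinM.
  - by move=> x'' _; rewrite lee_fin; exact: mulr_ge0 (sqr_ge0 _) (defect_r_ge0 _).
  - by rewrite lee_fin; exact: gamma_ge0.
apply: lee_wpmul2l; first by rewrite lee_fin; exact: gamma_ge0.
rewrite integral_mkcond; apply: ge0_le_integral_nonmeas => x'' _.
  by rewrite patchE; case: ifPn => // _; rewrite lee_fin curv_ge0.
(* Where [grad_r u] vanishes, the right-hand side is still nonnegative. *)
rewrite patchE; case: ifPn => [|_]; last first.
  by rewrite lee_fin; exact: mulr_ge0 (sqr_ge0 _) (defect_r_ge0 _).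
rewrite inE /= => ux; rewrite lee_fin; apply: ler_wpM2l; first exact: sqr_ge0.
exact: curvature_le_defect_r.
Qed.

End estimate.
End stability.

Lemma compact_support_box (R : realType) n (phi : 'rV[R]_n -> R) :
  compact (closure [set x | phi x != 0]) -> exists M, zero_off_box M phi.
Proof.
move=> /compact_bounded[C [_ hC]]; exists (`|C| + 1) => x xM.
apply/eqP; apply: contra_notT xM => px i.
have CC : C < `|C| + 1 by rewrite (le_lt_trans (ler_norm _))// ltrDl.
apply: le_trans (hC _ CC x _); last exact: subset_closure.
by rewrite [leRHS]/Num.Def.normr/= mx_normrE; exact: (le_bigmax _ _ (0, i)).
Qed.

Theorem theorem3 (R : realType) (d s : nat) (hd : (1 <= d)%N) (hs : (1 <= s)%N)
    (gamma lambda : 'rV[R]_d -> R)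
    (gamma_smooth : smooth gamma) (gamma_gt0 : forall x', 0 < gamma x')
    (lambda_smooth : smooth lambda) (lambda_ge0 : forall x', 0 <= lambda x')
    (f : R -> R) (f_C1 : C1_real f)
    (u : 'rV[R]_(d + s) -> R)
    (u_sol : classical_solution gamma lambda f u)
    (u_stable : stable gamma lambda f u)
    (phi : 'rV[R]_(d + s) -> R) (phi_C1c : C1c phi) :
  (\int[lebesgue_rV R d]_x'
     ((gamma x')%:E *
      \int[lebesgue_rV R s]_(x'' in
          [set x'' : 'rV[R]_s | grad_r u (row_mx x' x'') != 0%R])
        let x := row_mx x' x'' in
        (phi x ^+ 2 *
           (norm_grad_r u x ^+ 2 * curvature u x ^+ 2
            + enorm (grad_T u (norm_grad_r u) x) ^+ 2))%:E)
   + \int[lebesgue_rV R (d + s)]_x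
       (gamma (lsubmx x) * phi x ^+ 2 * calS u x)%:E
   <= \int[lebesgue_rV R (d + s)]_x
       (gamma (lsubmx x) * norm_grad_r u x ^+ 2 * enorm (grad phi x) ^+ 2)%:E)%E.
Proof.
have [M phi0] := compact_support_box phi_C1c.2.
apply: (@stability_poincare R d s u u_sol.1 gamma lambda f M (gamma_smooth 1%N) _
  (lambda_smooth 1%N) f_C1 u_sol.2 phi phi_C1c.1 phi0 phi_C1c.2 u_stable) => x'.
exact: ltW.
Qed.
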